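(* Let $d,n\ge2$, $\beta>0$, and let weights $J_1,\ldots,J_d\ge0$ with $\sum_{i=1}^d\kappa_iJ_i\le1$ be fixed (independent of $m$). For $m>0$ let $(g_x)_{x\in\mathcal X}$ be the Gaussian free field without boundary on the Hamming graph $\mathcal X=\{0,1,\ldots,n-1\}^d$ with these weights, mass $m$ and inverse temperature $\beta$, and let $Z_{\mathcal X}$ be its partition function, as defined in the context. (i) As $m\to\infty$, the scaled field $(\sqrt\beta\,m\,g_x)_{x\in\mathcal X}$ converges weakly to a collection of independent standard Gaussian random variables. (ii) Assume that the stochastic matrix $P$ (defined in the context) is irreducible. Then, as $m\to0$, $$mZ_{\mathcal X}\to\left(\frac{2\pi}\beta\right)^{n^d/2}\prod_{i=1}^d(1-\lambda_i)^{-\kappa_i/2}.$$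
   Context: $\rho(x,x')=|\{i:x_i\ne x_i'\}|$ is the Hamming distance; $R_i=\{(x,x')\in\mathcal X\times\mathcal X:\rho(x,x')=i\}$ (ordered pairs); $\kappa_i=\binom di(n-1)^i$. The Hamiltonian is $H\{(\xi_x)\}=\frac14\sum_{i=1}^dJ_i\sum_{(x,x')\in R_i}(\xi_x-\xi_{x'})^2+\frac{m^2}2\sum_{x\in\mathcal X}\xi_x^2$; $(g_x)_{x\in\mathcal X}$ is the random vector in $\mathbb R^{\mathcal X}$ with density $e^{-\beta H}/Z_{\mathcal X}$, where $Z_{\mathcal X}=\int_{\mathbb R^{\mathcal X}}e^{-\beta H\{(\xi_x)\}}\prod_{x\in\mathcal X}d\xi_x$. Put $w_i=\kappa_iJ_i$ for $1\le i\le d$, $w_0=1-\sum_{i=1}^dw_i$; the stochastic matrix $P$ on $\mathcal X$ is $(P)_{x,x'}=w_{\rho(x,x')}/\kappa_{\rho(x,x')}$, and $$\lambda_i=\sum_{j=0}^d\frac{w_j}{\kappa_j}K_j(i),\qquad K_i(j)=\sum_{l=\max(0,i+j-d)}^{\min(i,j)}(-1)^l(n-1)^{i-l}\binom jl\binom{d-j}{i-l}$$ (Krawtchouk polynomials). *)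

(* Defs.v *)
From HB Require Import structures.
From mathcomp Require Import all_boot all_order all_algebra.
From mathcomp Require Import all_classical all_reals all_analysis.

Set Implicit Arguments.
Unset Strict Implicit.
Unset Printing Implicit Defensive.

Import Order.TTheory GRing.Theory Num.Theory.
Import numFieldNormedType.Exports.

Local Open Scope classical_set_scope.
Local Open Scope ring_scope.

(* [{ptws X -> T}] carries the topology of pointwise convergence; equip it with
   the product sigma-algebra as well (for finite X and T = R, this is the usual
   Borel structure of R^X). *)
Section product_sigma_algebra.
Context d (X : Type) (T : measurableType d).

Definition coordinate_sets : set (set {ptws X -> T}) :=
  \bigcup_(x in [set: X])
    preimage_set_system [set: {ptws X -> T}] (fun xi => xi x) measurable.

Definition measure_ptws_display : measure_display -> measure_display.
Proof. exact. Qed.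

HB.instance Definition _ := Pointed.copy {ptws X -> T} (X -> T).

HB.instance Definition _ := @isMeasurable.Build (measure_ptws_display d)
  {ptws X -> T} <<s coordinate_sets >>
  (@sigma_algebra0 _ setT coordinate_sets)
  (fun A => @sigma_algebraC _ coordinate_sets A)
  (@sigma_algebra_bigcup _ setT coordinate_sets).

Lemma measurable_ptws_eval (x : X) :
  measurable_fun [set: {ptws X -> T}] (fun xi : {ptws X -> T} => xi x).
Proof.
move=> _ A mA; apply: sub_sigma_algebra; exists x => //.
by exists A.
Qed.

Lemma measurable_ptws d' (S : measurableType d') (f : S -> {ptws X -> T}) :
  (forall x, measurable_fun [set: S] (fun s => f s x)) ->
  measurable_fun [set: S] f.
Proof.
move=> mf; apply: (@measurability _ _ _ _ _ _ coordinate_sets) => //.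
move=> _ [_ [x _ [A mA <-]] <-].
rewrite setTI -comp_preimage.
exact: (mf x).
Qed.

End product_sigma_algebra.

(* Image of a sigma-finite measure under a measurable map with a measurable left
   inverse. *)
Section image_measure.
Context d1 d2 (T1 : measurableType d1) (T2 : measurableType d2) (R : realType).
Context (f : T1 -> T2) (g : T2 -> T1).
Context (mf : measurable_fun [set: T1] f) (mg : measurable_fun [set: T2] g).
Context (fK : cancel f g).

Definition image_measure of measurable_fun [set: T1] f
    & measurable_fun [set: T2] g & cancel f g :=
  fun m : {sigma_finite_measure set T1 -> \bar R} => pushforward m f.

Variable m : {sigma_finite_measure set T1 -> \bar R}.

Local Notation image_m := (image_measure mf mg fK m).

Let image0 : image_m set0 = 0%E.
Proof. by rewrite /image_measure /pushforward preimage_set0 measure0. Qed.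

Let image_ge0 A : (0 <= image_m A)%E.
Proof. exact: measure_ge0. Qed.

Let image_sigma_additive : semi_sigma_additive image_m.
Proof.
have mpre A : measurable A -> measurable (f @^-1` A).
  by move=> mA; rewrite -[X in measurable X]setTI; exact: mf.
move=> F mF tF mUF; rewrite /image_measure /pushforward preimage_bigcup.
apply: measure_semi_sigma_additive => [i||]; first exact: mpre.
- apply/trivIsetP => i j _ _ ij; rewrite -preimage_setI.
  by move/trivIsetP : tF => /(_ _ _ I I ij) ->; rewrite preimage_set0.
- by rewrite -preimage_bigcup; exact: mpre.
Qed.

HB.instance Definition _ := isMeasure.Build _ _ _ image_m
  image0 image_ge0 image_sigma_additive.

Let image_sigma_finite : sigma_finite setT image_m.
Proof.
have [F FT mF] := sigma_finiteT m.
exists (fun k => g @^-1` F k).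
  by rewrite -preimage_bigcup -FT preimage_setT.
move=> k; have [mFk Fkoo] := mF k; split.
  by rewrite -[X in measurable X]setTI; exact: mg.
rewrite /image_measure /pushforward -comp_preimage.
by rewrite (_ : g \o f = id) //; exact/funext.
Qed.

HB.instance Definition _ :=
  Measure_isSigmaFinite.Build _ _ _ image_m image_sigma_finite.

End image_measure.

(* The library only infers sigma-finiteness of [m1 \x m2] for finite factors, hence
   this alias. *)
Section sigma_finite_product.
Context d1 d2 (T1 : measurableType d1) (T2 : measurableType d2) (R : realType).
Variables (m1 : {sigma_finite_measure set T1 -> \bar R}).
Variables (m2 : {sigma_finite_measure set T2 -> \bar R}).

Definition sigma_finite_product : set (T1 * T2) -> \bar R := (m1 \x m2)%E.

HB.instance Definition _ := Measure.copy sigma_finite_product (m1 \x m2)%E.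

Let product_sigma_finite : sigma_finite setT sigma_finite_product.
Proof.
have /sigma_finiteP[F [TF ndF Foo]] := sigma_finiteT m1.
have /sigma_finiteP[G [TG ndG Goo]] := sigma_finiteT m2.
exists (fun n => F n `*` G n).
  rewrite -setXTT TF TG predeqE => -[x y]; split.
    move=> [/= [n _ Fnx] [k _ Gky]]; exists (maxn n k) => //; split.
    - by move: x Fnx; exact/subsetPset/ndF/leq_maxl.
    - by move: y Gky; exact/subsetPset/ndG/leq_maxr.
  by move=> [n _ []/= ? ?]; split; exists n.
move=> k; have [? ?] := Foo k; have [? ?] := Goo k.
split; first exact: measurableX.
rewrite [ltLHS]product_measure1E// lte_mul_pinfty//.
by rewrite ge0_fin_numE.
Qed.

HB.instance Definition _ :=
  Measure_isSigmaFinite.Build _ _ _ sigma_finite_product product_sigma_finite.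

End sigma_finite_product.

(* The product of n copies of mu, by recursion on n. *)
Section tuple_power.
Context d (T : measurableType d) (R : realType).
Variable mu : {sigma_finite_measure set T -> \bar R}.

Definition tuple_cons n (p : T * n.-tuple T) : n.+1.-tuple T :=
  [tuple of p.1 :: p.2].

Definition tuple_uncons n (t : n.+1.-tuple T) : T * n.-tuple T :=
  (thead t, [tuple of behead t]).

Lemma tuple_consK n : cancel (@tuple_cons n) (@tuple_uncons n).
Proof.
by move=> [x t]; rewrite /tuple_uncons theadE; congr pair; exact: val_inj.
Qed.

Lemma measurable_tuple_cons n : measurable_fun setT (@tuple_cons n).
Proof. exact: measurable_cons. Qed.

Lemma measurable_tuple_uncons n : measurable_fun setT (@tuple_uncons n).
Proof.
by apply: measurable_fun_pair; [exact: measurable_tnth|exact: measurable_behead].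
Qed.

Fixpoint tuple_power n : {sigma_finite_measure set (n.-tuple T) -> \bar R} :=
  match n with
  | 0 => \d_([tuple] : 0.-tuple T)
  | n.+1 => image_measure (@measurable_tuple_cons n)
              (@measurable_tuple_uncons n) (@tuple_consK n)
              (sigma_finite_product mu (tuple_power n))
  end.

Lemma tuple_power_rect n (A : 'I_n -> set T) :
  (forall i, measurable (A i)) ->
  tuple_power n [set t | forall i, A i (tnth t i)] =
  (\prod_(i < n) mu (A i))%E.
Proof.
elim: n A => [|n IHn] A mA.
  by rewrite big_ord0 /= diracE mem_set //; case.
rewrite big_ord_recl -IHn; last by move=> i; exact: mA.
rewrite /= /image_measure /pushforward /sigma_finite_product.
rewrite -product_measure1E //.
  congr (_ _); apply/seteqP; split => [[x t] /= H|[x t] /= [Hx Ht] i].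
    split; first by have := H ord0; rewrite tnth0.
    by move=> i; have := H (lift ord0 i); rewrite tnthS.
  case: (unliftP ord0 i) => [j|] ->; first by rewrite tnthS.
  by rewrite tnth0.
rewrite (_ : [set t | _] = \bigcap_(i in [set: 'I_n])
    ((fun t : n.-tuple T => tnth t i) @^-1` A (lift ord0 i))).
  apply: fin_bigcap_measurable => // i _; rewrite -[X in measurable X]setTI.
  exact: measurable_tnth.
by apply/seteqP; split => t /= H i => [_|]; exact: H.
Qed.

End tuple_power.

(* The product of copies of mu indexed by a finite type X; by [ptws_power_rect] it
   does not depend on the enumeration of X used to define it. *)
Section ptws_power.
Context d (T : measurableType d) (R : realType) (X : finType).
Variable mu : {sigma_finite_measure set T -> \bar R}.

Definition ptws_of_tuple (t : #|X|.-tuple T) : {ptws X -> T} :=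
  fun x => tnth t (enum_rank x).

Definition tuple_of_ptws (xi : {ptws X -> T}) : #|X|.-tuple T :=
  [tuple xi (enum_val i) | i < #|X|].

Lemma ptws_of_tupleK : cancel ptws_of_tuple tuple_of_ptws.
Proof.
by move=> t; apply: eq_from_tnth => i; rewrite tnth_mktuple /ptws_of_tuple enum_valK.
Qed.

Lemma measurable_ptws_of_tuple : measurable_fun setT ptws_of_tuple.
Proof. by apply: measurable_ptws => x; exact: measurable_tnth. Qed.

Lemma measurable_tuple_of_ptws : measurable_fun setT tuple_of_ptws.
Proof.
apply/measurable_fun_tnthP => i.
rewrite (_ : _ \o _ = fun xi : {ptws X -> T} => xi (enum_val i)).
  exact: measurable_ptws_eval.
by apply/funext => xi /=; rewrite tnth_mktuple.
Qed.

Definition ptws_power : {sigma_finite_measure set {ptws X -> T} -> \bar R} :=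
  image_measure measurable_ptws_of_tuple measurable_tuple_of_ptws
    ptws_of_tupleK (tuple_power mu #|X|).

Lemma ptws_power_rect (A : X -> set T) :
  (forall x, measurable (A x)) ->
  ptws_power [set xi | forall x, A x (xi x)] = (\prod_x mu (A x))%E.
Proof.
move=> mA.
transitivity (\prod_(i < #|X|) mu (A (enum_val i)))%E; last first.
  by rewrite [RHS](reindex _ (onW_bij _ (enum_val_bij X))).
rewrite -(tuple_power_rect mu (A := fun i => A (enum_val i))) //.
congr (tuple_power mu _ _); apply/seteqP; split => t /= H i.
  by have := H (enum_val i); rewrite /ptws_of_tuple enum_valK.
by have := H (enum_rank i); rewrite enum_rankK.
Qed.

End ptws_power.

Section lebesgue.
Variable R : realType.

Lemma measurable_to_real : measurable_fun [set: measurableTypeR R] (id : _ -> R).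
Proof. by move=> _ A mA; rewrite setTI. Qed.

Lemma measurable_from_real : measurable_fun [set: R] (id : _ -> measurableTypeR R).
Proof. by move=> _ A mA; rewrite setTI. Qed.

(* [lebesgue_measure] lives on the type alias [measurableTypeR R]; this is the same
   set function, seen on R with its canonical measurable structure. *)
Definition real_lebesgue : {sigma_finite_measure set R -> \bar R} :=
  image_measure measurable_to_real measurable_from_real
    (fun=> erefl) lebesgue_measure.

Lemma real_lebesgueE : real_lebesgue = lebesgue_measure :> (set R -> \bar R).
Proof. by []. Qed.

(* Lebesgue measure on R^X. *)
Definition ptws_lebesgue (X : finType) :
  {sigma_finite_measure set {ptws X -> R} -> \bar R} :=
  ptws_power X real_lebesgue.

End lebesgue.

Section hamming_graph.
Variables d n : nat.

Definition vertex := {ffun 'I_d -> 'I_n}.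

Definition hdist (x y : vertex) : nat := #|[set i | x i != y i]%SET|.

Definition hrel (i : nat) : {set vertex * vertex} :=
  [set p | hdist p.1 p.2 == i]%SET.

Definition kappa (i : nat) : nat := ('C(d, i) * (n - 1) ^ i)%N.

Section weights.
Variables (R : realType) (J : nat -> R).

Definition hamiltonian (m : R) (xi : {ptws vertex -> R}) : R :=
  4^-1 * (\sum_(1 <= i < d.+1)
            J i * \sum_(p in hrel i) (xi p.1 - xi p.2) ^+ 2)
  + m ^+ 2 / 2 * \sum_(x : vertex) xi x ^+ 2.

Definition partition_function (beta m : R) : \bar R :=
  (\int[ptws_lebesgue R vertex]_xi (expR (- (beta * hamiltonian m xi)))%:E)%E.

Definition is_gff (beta m : R) (d0 : measure_display) (Om : measurableType d0)
    (P : probability Om R) (g : vertex -> {RV P >-> R}) : Prop :=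
  forall A : set {ptws vertex -> R}, measurable A ->
    P [set w | A (fun x => g x w)] =
    (\int[ptws_lebesgue R vertex]_(xi in A)
       (expR (- (beta * hamiltonian m xi)) / fine (partition_function beta m))%:E)%E.

Definition weight (i : nat) : R :=
  if i == 0%N then 1 - \sum_(1 <= j < d.+1) (kappa j)%:R * J j
  else (kappa i)%:R * J i.

Definition transition : 'M[R]_#|vertex| :=
  \matrix_(a, b) (weight (hdist (enum_val a) (enum_val b)) /
                  (kappa (hdist (enum_val a) (enum_val b)))%:R).

(* The lower summation bound is max(0, i + j - d), nat subtraction being
   truncated. *)
Definition krawtchouk (i j : nat) : R :=
  \sum_((i + j - d)%N <= l < (minn i j).+1)
    (-1) ^+ l * (n - 1)%:R ^+ (i - l) * 'C(j, l)%:R * 'C(d - j, i - l)%:R.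

Definition eigenval (i : nat) : R :=
  \sum_(0 <= j < d.+1) weight j / (kappa j)%:R * krawtchouk j i.

End weights.
End hamming_graph.

Definition irreducible_mx (R : realType) (k : nat) (M : 'M[R]_k) : Prop :=
  forall a b, exists t : nat, 0 < (M ^+ t) a b.

Definition iid_std_gaussian (R : realType) (X : finType) (d0 : measure_display)
    (Om : measurableType d0) (P : probability Om R) (N : X -> {RV P >-> R}) : Prop :=
  (forall x (B : set R), measurable B ->
     distribution P (N x) B = normal_prob 0 1 B) /\
  (forall (S : {set X}) (B : X -> set R), (forall x, measurable (B x)) ->
     P [set w | forall x, x \in S -> B x (N x w)] =
     (\prod_(x in S) P [set w | B x (N x w)])%E).

(* Each Y i and the limit N may live on their own probability spaces; [f] ranges
   over the bounded continuous functions on R^X. *)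
Definition cvg_weakly (R : realType) (X : finType) (I : Type) (F : set_system I)
    (d0 : I -> measure_display) (Om : forall i, measurableType (d0 i))
    (P : forall i, probability (Om i) R) (Y : forall i, X -> Om i -> R)
    (d1 : measure_display) (Om1 : measurableType d1) (P1 : probability Om1 R)
    (N : X -> Om1 -> R) : Prop :=
  forall f : {ptws X -> R} -> R, continuous f ->
    (exists M : R, forall xi, `|f xi| <= M) ->
    ('E_(P i)[fun w => f (fun x => Y i x w)] @[i --> F] -->
     'E_P1[fun w => f (fun x => N x w)])%E.

(* Main.v *)
Require Import Defs.
From HB Require Import structures.
From mathcomp Require Import all_boot all_order all_algebra.
From mathcomp Require Import all_classical all_reals all_analysis.
From mathcomp Require Import measurable_realfun.
From mathcomp Require Import ring lra zify.

(* The Hamiltonian is the quadratic form xi^T (I - P + m^2) xi / 2.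

   (i) In the coordinates eta = sqrt(beta) m xi the density of the field, with
   respect to the standard Gaussian measure gamma on R^X, is proportional to
   exp(- eta^T (I - P) eta / (2 m^2)), which is at most 1 and tends to 1 as
   m -> oo.  Dominated convergence under gamma gives the weak limit.

   (ii) A Gaussian integral is evaluated by integrating out one coordinate at a
   time: completing the square replaces the matrix by its Schur complement, so
   the result is sqrt((2 pi)^N / det).  The functions
   x |-> prod_i phi_(k_i)(x_i), with phi_0 = 1 and phi_a = 1_a - 1_0, form a basis
   of common eigenvectors of all functions of the Hamming distance; since
   sum_y X^(rho(x, y)) f(y) factors over coordinates for such f, the eigenvalues
   are the coefficients of (1 - X)^j (1 + (n - 1) X)^(d - j), that is the
   Krawtchouk values K_i(j), with multiplicity kappa_j.  Hence
   det = beta^N m^2 prod_(i >= 1) (1 + m^2 - lambda_i)^(kappa_i).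
   Finally lambda_i < 1 for i >= 1: the Dirichlet form vanishes only on functions
   constant along the edges of P, hence constant when P is irreducible. *)

Set Implicit Arguments.
Unset Strict Implicit.
Unset Printing Implicit Defensive.

Import Order.TTheory GRing.Theory Num.Theory.
Import numFieldNormedType.Exports.

Local Open Scope classical_set_scope.
Local Open Scope ring_scope.

(** * Krawtchouk eigenvalues of radial matrices on the Hamming graph *)

Section product_basis.
Variables (R : realType) (d n' : nat).
Local Notation n := n'.+1.
Implicit Types k x y : vertex d n.

(** Basis functions are indexed by vertices; the distance from [zvertex] to an index counts the
    coordinates whose factor is not phi_0. *)
Definition zvertex : vertex d n := [ffun=> ord0].

(* The rows of basis1 are phi_0 = 1 and phi_k = 1_k - 1_0; dual1 is its inverse. *)
Definition basis1 (k a : 'I_n) : R :=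
  if k == ord0 then 1 else (a == k)%:R - (a == ord0)%:R.

Definition dual1 (k a : 'I_n) : R :=
  if k == ord0 then n%:R^-1 else (a == k)%:R - n%:R^-1.

Definition tensor_basis k x : R := \prod_i basis1 (k i) (x i).
Definition tensor_dual k x : R := \prod_i dual1 (k i) (x i).

Lemma sum_delta (F : 'I_n -> R) (k : 'I_n) : \sum_a (a == k)%:R * F a = F k.
Proof.
rewrite (bigD1 k)//= eqxx mul1r big1 ?addr0// => a /negPf ->.
by rewrite mul0r.
Qed.

Lemma sum_basis1 (k : 'I_n) : k != ord0 -> \sum_a basis1 k a = 0.
Proof.
rewrite /basis1 => /negPf ->; rewrite sumrB.
have E l : \sum_(a : 'I_n) (a == l)%:R = 1 :> R.
  by under eq_bigr do rewrite -[_%:R]mulr1; rewrite (sum_delta (fun=> 1)).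
by rewrite !E subrr.
Qed.

(** [dual1 ord0] takes the mean of a function, any other [dual1 k] its value at k minus the mean.
    The phi_l with l nonzero have mean 0, and phi_0 is constantly 1. *)
Lemma dual1_basis1 (k l : 'I_n) : \sum_a dual1 k a * basis1 l a = (k == l)%:R.
Proof.
have n0 : n%:R != 0 :> R by rewrite pnatr_eq0.
rewrite /dual1; case: (eqVneq k ord0) => [->|k0].
  rewrite -mulr_sumr; case: (eqVneq l ord0) => [->|l0].
    rewrite /basis1 eqxx ?eqxx sumr_const card_ord.
    by rewrite mulVf.
  by rewrite sum_basis1// mulr0.
under eq_bigr do rewrite mulrBl; rewrite sumrB sum_delta -mulr_sumr.
case: (eqVneq l ord0) => [->|l0].
  rewrite (negPf k0) /basis1 eqxx sumr_const card_ord.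
  by rewrite mulVf// subrr.
by rewrite sum_basis1// mulr0 subr0 /basis1 (negPf l0) (negPf k0) subr0.
Qed.

(** Distributivity turns the sum over vertices into a product of one-coordinate pairings; a
    coordinate where k and l differ gives a zero factor. *)
Lemma dual_basis k l : \sum_x tensor_dual k x * tensor_basis l x = (k == l)%:R.
Proof.
rewrite /tensor_dual /tensor_basis; under eq_bigr do rewrite -big_split/=.
rewrite -(bigA_distr_bigA (fun i a => dual1 (k i) a * basis1 (l i) a)).
under eq_bigr do rewrite dual1_basis1.
case: (eqVneq k l) => [->|kl]; first by rewrite big1// => i _; rewrite eqxx.
have [i kli] : exists i, k i != l i.
  apply/existsP; rewrite -negb_forall; apply: contra kl => /forallP H.
  by apply/eqP/ffunP => i; exact/eqP.
by rewrite (bigD1 i)//= (negPf kli) mul0r.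
Qed.

Lemma hdistE x y : hdist x y = (\sum_i (x i != y i))%N.
Proof. by rewrite /hdist cardsE -sum1_card big_mkcond. Qed.

Lemma hdist_le x y : (hdist x y <= d)%N.
Proof. by rewrite /hdist (leq_trans (max_card _))// card_ord. Qed.

(** The sum of phi_k off b is its total minus phi_k(b), and the total is n for phi_0 and 0
    otherwise. *)
Lemma sum_X_basis1 (k b : 'I_n) :
  \sum_a 'X^(b != a) * (basis1 k a)%:P =
  (if k == ord0 then 1 + n'%:R *: 'X else 1 - 'X) * (basis1 k b)%:P :> {poly R}.
Proof.
rewrite (bigD1 b)//= eqxx expr0 mul1r.
under eq_bigr => a ab do rewrite eq_sym ab expr1.
rewrite -mulr_sumr -rmorph_sum/=.
have E : \sum_(a | a != b) basis1 k a =
    if k == ord0 then n'%:R else - basis1 k b.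
  case: ifPn => [/eqP ->|/sum_basis1].
    by rewrite /basis1 eqxx sumr_const cardC1 card_ord.
  by rewrite (bigD1 b)//= => /eqP; rewrite addrC addr_eq0 => /eqP.
rewrite E; case: ifPn => [/eqP ->|_].
  by rewrite /basis1 eqxx polyC1 mulr1 -mul_polyC mulrC.
by rewrite polyCN mulrBl mul1r mulrN.
Qed.

(** The power of X and the basis function are both products over coordinates, so the sum factors and
    [sum_X_basis1] evaluates each factor. The variable X treats all distances at once. *)
Lemma sum_X_basis k x :
  \sum_y 'X^(hdist x y) * (tensor_basis k y)%:P =
  (1 - 'X) ^+ (hdist zvertex k) * (1 + n'%:R *: 'X) ^+ (d - hdist zvertex k) *
  (tensor_basis k x)%:P :> {poly R}.
Proof.
have -> : \sum_y 'X^(hdist x y) * (tensor_basis k y)%:P =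
    \sum_(y : vertex d n) \prod_i ('X^(x i != y i) * (basis1 (k i) (y i))%:P) :> {poly R}.
  apply: eq_bigr => y _; rewrite big_split/= rmorph_prod.
  by rewrite hdistE -prodrXr.
rewrite -(bigA_distr_bigA (fun i a => 'X^(x i != a) * (basis1 (k i) a)%:P)).
under eq_bigr do rewrite sum_X_basis1.
rewrite big_split/= -rmorph_prod; congr (_ * _).
rewrite (bigID (fun i => k i == ord0))/= mulrC; congr (_ * _).
  rewrite (eq_bigr (fun=> 1 - 'X)); last by move=> i /negPf ->.
  rewrite prodr_const /hdist; congr (_ ^+ _); apply: eq_card => i.
  by rewrite !inE ffunE eq_sym.
rewrite (eq_bigr (fun=> 1 + n'%:R *: 'X)); last by move=> i ->.
rewrite prodr_const; congr (_ ^+ _).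
have := cardC [set i | zvertex i != k i]%SET; rewrite card_ord => E.
rewrite -[X in _ = (X - _)%N]E /hdist addKn; apply: eq_card => i.
by rewrite !inE ffunE negbK eq_sym.
Qed.

Lemma coef_linear_exp (c : R) (a j : nat) :
  ((1 + c *: 'X) ^+ a)`_j = c ^+ j * 'C(a, j)%:R.
Proof.
rewrite exprDn coef_sum.
under eq_bigr => i _ do
  rewrite expr1n mul1r exprZn coefMn coefZ coefXn.
case: (ltnP j a.+1) => ja.
  rewrite (bigD1 (Ordinal ja))//= eqxx mulr1 mulr_natr big1 ?addr0// => i ij.
  by rewrite eq_sym -val_eqE/= in ij *; rewrite (negPf ij) mulr0 mul0rn.
rewrite bin_small// mulr0 big1// => i _.
by rewrite gtn_eqF ?mulr0 ?mul0rn// (leq_trans (ltn_ord i)).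
Qed.

(** Cauchy product of two binomial expansions. The full range 0 <= l <= i shrinks to the Krawtchouk
    range because C(j, l) vanishes for l > j and C(d - j, i - l) for l < i + j - d. *)
Lemma krawtchoukE (i j : nat) : (i <= d)%N -> (j <= d)%N ->
  krawtchouk d n R i j = ((1 - 'X) ^+ j * (1 + n'%:R *: 'X) ^+ (d - j) : {poly R})`_i.
Proof.
move=> id jd; rewrite coefM.
have -> : 1 - 'X = 1 + (-1) *: 'X :> {poly R} by rewrite scaleN1r.
under eq_bigr do rewrite !coef_linear_exp.
rewrite /krawtchouk subn1/=.
pose F l : R := (-1) ^+ l * n'%:R ^+ (i - l) * 'C(j, l)%:R * 'C(d - j, i - l)%:R.
transitivity (\sum_(0 <= l < i.+1) F l); last first.
  by rewrite big_mkord; apply: eq_bigr => l _; rewrite /F; ring.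
have lo : (i + j - d <= (minn i j).+1)%N by rewrite leqW// leq_min; lia.
rewrite [RHS](@big_cat_nat _ _ _ (minn i j).+1)//=; last by rewrite ?ltnS geq_minl.
rewrite [X in _ = _ + X]big_nat_cond [X in _ = _ + X]big1 ?addr0; last first.
  move=> l /andP[/andP[l1 l2] _]; rewrite /F (@bin_small j l) ?mulr0 ?mul0r//.
  by move: l1 l2; rewrite /minn; case: ifP; lia.
rewrite [RHS](@big_cat_nat _ _ _ (i + j - d)%N)//=.
rewrite [X in _ = X + _]big_nat_cond [X in _ = X + _]big1 ?add0r//.
move=> l /andP[/andP[l1 l2] _]; rewrite /F (@bin_small (d - j)) ?mulr0//.
by lia.
Qed.

(** This compares the coefficients of X^j on the two sides of [sum_X_basis]. *)
Lemma sum_hdist_basis (j : nat) k x : (j <= d)%N ->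
  \sum_(y | hdist x y == j) tensor_basis k y =
  krawtchouk d n R j (hdist zvertex k) * tensor_basis k x.
Proof.
move=> jd; rewrite krawtchoukE ?hdist_le// -coefMC -sum_X_basis coef_sum.
rewrite big_mkcond; apply: eq_bigr => y _.
by rewrite coefMC coefXn eq_sym; case: eqP => _; rewrite ?mul1r ?mul0r.
Qed.

(** The basis function of [zvertex] is constantly 1, so the sphere has size K_i(0). The count is
    carried out in R and cast back to nat. *)
Lemma card_hdist (i : nat) x : (i <= d)%N ->
  (\sum_(y | hdist x y == i) 1 = kappa d n i)%N.
Proof.
move=> id; apply/eqP; rewrite -(eqr_nat R) natr_sum; apply/eqP.
transitivity (\sum_(y | hdist x y == i) tensor_basis zvertex y).
  by apply: eq_bigr => y _; rewrite /tensor_basis big1// => j _; rewrite ffunE /basis1 eqxx.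
rewrite sum_hdist_basis// krawtchoukE ?hdist_le//.
have -> : hdist zvertex zvertex = 0%N.
  by rewrite hdistE big1// => j _; rewrite eqxx.
rewrite expr0 mul1r subn0 coef_linear_exp /tensor_basis big1 ?mulr1; last first.
  by move=> j _; rewrite ffunE /basis1 eqxx.
by rewrite /kappa subn1/= natrM natrX mulrC.
Qed.

Lemma sum_hdist (G : nat -> R) (F : vertex d n -> R) x :
  \sum_y G (hdist x y) * F y =
  \sum_(0 <= j < d.+1) G j * \sum_(y | hdist x y == j) F y.
Proof.
(* The classes need labels in a finite type; [inord] is faithful here because distances are at most
   d. *)
rewrite big_mkord (partition_big (fun y => inord (hdist x y) : 'I_d.+1) predT)//=.
apply: eq_bigr => j _; rewrite mulr_sumr; apply: eq_big => y.
  by rewrite -val_eqE/= inordK// ltnS hdist_le.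
by move=> /eqP <-; rewrite inordK// ltnS hdist_le.
Qed.

Definition radial_eigenval (G : nat -> R) (i : nat) : R :=
  \sum_(0 <= j < d.+1) G j * krawtchouk d n R j i.

Lemma radial_basis (G : nat -> R) k x :
  \sum_y G (hdist x y) * tensor_basis k y =
  radial_eigenval G (hdist zvertex k) * tensor_basis k x.
Proof.
rewrite sum_hdist /radial_eigenval mulr_suml.
apply: eq_big_nat => j /andP[_ jd].
by rewrite sum_hdist_basis// mulrA.
Qed.

Definition radial_mx (G : nat -> R) : 'M[R]_#|vertex d n| :=
  \matrix_(a, b) G (hdist (enum_val a) (enum_val b)).

(** With the basis as columns of [Phi], the matrix satisfies G Phi = Phi D, and [Psi] shows that det
    Phi is nonzero, so it cancels. Grouping the diagonal by distance from [zvertex] gives the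
    multiplicities. *)
Lemma det_radial_mx (G : nat -> R) :
  \det (radial_mx G) =
  \prod_(0 <= i < d.+1) radial_eigenval G i ^+ kappa d n i.
Proof.
pose Phi : 'M[R]_#|vertex d n| := \matrix_(a, b) tensor_basis (enum_val b) (enum_val a).
pose Psi : 'M[R]_#|vertex d n| := \matrix_(a, b) tensor_dual (enum_val a) (enum_val b).
pose D : 'rV[R]_#|vertex d n| :=
  \row_b radial_eigenval G (hdist zvertex (enum_val b)).
have sum_val (F : vertex d n -> R) :
    \sum_(a < #|vertex d n|) F (enum_val a) = \sum_x F x.
  by rewrite [RHS](reindex _ (onW_bij _ (enum_val_bij (vertex d n)))).
have PsiPhi : Psi *m Phi = 1%:M.
  apply/matrixP => a b; rewrite !mxE.
  under eq_bigr do rewrite !mxE.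
  rewrite (sum_val (fun x => tensor_dual (enum_val a) x * tensor_basis (enum_val b) x)).
  by rewrite dual_basis (inj_eq enum_val_inj).
have GPhi : radial_mx G *m Phi = Phi *m diag_mx D.
  apply/matrixP => a b; rewrite mul_mx_diag !mxE.
  under eq_bigr do rewrite !mxE.
  rewrite (sum_val (fun y => G (hdist (enum_val a) y) * tensor_basis (enum_val b) y)).
  by rewrite radial_basis mulrC.
have dPhi : \det Phi != 0.
  have := congr1 determinant PsiPhi; rewrite det_mulmx det1 => H.
  by apply/eqP => P0; move/eqP: H; rewrite P0 mulr0 eq_sym oner_eq0.
have -> : \det (radial_mx G) = \det (diag_mx D).
  apply: (mulIf dPhi); rewrite -det_mulmx GPhi det_mulmx mulrC //.
rewrite det_diag; under eq_bigr do rewrite mxE.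
transitivity (\prod_k radial_eigenval G (hdist zvertex k)).
  by rewrite [RHS](reindex _ (onW_bij _ (enum_val_bij (vertex d n)))).
rewrite big_mkord.
rewrite (partition_big (fun y => inord (hdist zvertex y) : 'I_d.+1) predT)//=.
apply: eq_bigr => i _.
rewrite (eq_bigr (fun=> radial_eigenval G i)); last first.
  by move=> y /eqP <-; rewrite inordK// ltnS hdist_le.
rewrite prodr_const -sum1_card; congr (_ ^+ _).
rewrite -(@card_hdist i zvertex) -1?ltnS//; apply: eq_bigl => y.
by rewrite unfold_in/= inordK// ltnS hdist_le.
Qed.

End product_basis.

(** * Integration against product measures *)

Section density.
Context d (T : measurableType d) (R : realType).
Variables (mu nu : {measure set T -> \bar R}) (rho : T -> R).
Hypotheses (rho_ge0 : forall x, 0 <= rho x) (mrho : measurable_fun setT rho).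
Hypothesis nuE : forall A, measurable A -> nu A = (\int[mu]_(x in A) (rho x)%:E)%E.

Local Open Scope ereal_scope.
Import HBNNSimple.

(** Monotone convergence along the simple approximations [h n], applied to both sides, reduces the
    claim to indicator functions, where it is [nuE]. *)
Lemma ge0_integral_density (f : T -> \bar R) :
  measurable_fun setT f -> (forall x, 0 <= f x) ->
  \int[nu]_x f x = \int[mu]_x (f x * (rho x)%:E).
Proof.
move=> mf f0; pose h := nnsfun_approx measurableT mf.
have mrhoE : measurable_fun setT (EFin \o rho) by exact/measurable_EFinP.
have hf x : (EFin \o h n) x @[n --> \oo] --> f x by exact: cvg_nnsfun_approx.
have nd_h x : {homo (fun n => (h n x)%:E) : a b / (a <= b)%N >-> a <= b}.
  by move=> a b ab; rewrite lee_fin; exact/lefP/nd_nnsfun_approx.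
have -> : \int[nu]_x f x = limn (fun n => \int[nu]_x (h n x)%:E).
  rewrite -monotone_convergence //.
  - by apply: eq_integral => x _; apply/esym/cvg_lim => //; exact: hf.
  - by move=> n; exact/measurable_EFinP.
  - by move=> n x _; rewrite lee_fin.
have -> : \int[mu]_x (f x * (rho x)%:E) =
    limn (fun n => \int[mu]_x ((h n x)%:E * (rho x)%:E)).
  rewrite -monotone_convergence //.
  - apply: eq_integral => x _; apply/esym/cvg_lim => //.
    by apply: cvgeZr => //; exact: hf.
  - by move=> n; apply: emeasurable_funM => //; exact/measurable_EFinP.
  - by move=> n x _; rewrite mule_ge0 ?lee_fin.
  - by move=> x _ a b ab; rewrite lee_wpmul2r ?lee_fin//; exact: nd_h.
suff suf n : \int[nu]_x (h n x)%:E = \int[mu]_x ((h n x)%:E * (rho x)%:E).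
  by under eq_fun do rewrite suf.
transitivity (\int[nu]_x
   (\sum_(y \in range (h n)) (y * \1_(h n @^-1` [set y]) x)%:E)).
  by apply: eq_integral => t _; rewrite /= fimfunE -fsumEFin.
have mind r : measurable_fun setT (fun x => (r * \1_(h n @^-1` [set r]) x)%:E).
  by apply: (measurable_comp measurableT) => //; exact: measurable_funM.
rewrite ge0_integral_fsum//; last by move=> m y _; exact: nnfun_muleindic_ge0.
transitivity (\int[mu]_x (\sum_(y \in range (h n))
    (y * \1_(h n @^-1` [set y]) x)%:E * (rho x)%:E)); last first.
  apply: eq_integral => x _.
  rewrite -ge0_mule_fsuml => [|y]; last exact: nnfun_muleindic_ge0.
  by rewrite fsumEFin // -(fimfunE _ x).
rewrite ge0_integral_fsum//; last 2 first.
  - by move=> y; apply: emeasurable_funM.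
  - move=> m y _; apply: mule_ge0; last by rewrite lee_fin.
    exact: nnfun_muleindic_ge0.
apply: eq_fsbigr => r /[!inE] -[x _ rE].
have r0 : (0 <= r)%R by rewrite -rE.
have mA : measurable (h n @^-1` [set r]) by [].
transitivity (r%:E * nu (h n @^-1` [set r])).
  under eq_integral do rewrite EFinM.
  rewrite ge0_integralZl//; last exact/measurable_EFinP/measurable_indic.
  by rewrite integral_indic// setIT.
rewrite nuE//.
under [RHS]eq_integral do rewrite EFinM -muleA.
rewrite ge0_integralZl//.
- congr (_ * _); rewrite integral_mkcond; apply: eq_integral => y _.
  by rewrite patchE indicE; case: ifPn => _; rewrite ?mul1e ?mul0e.
- by apply: emeasurable_funM => //; exact/measurable_EFinP/measurable_indic.
- by move=> y _; rewrite mule_ge0 ?lee_fin.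
Qed.

End density.

(** * Iterated integrals over tuples *)

Section tuple_power_integral.
Context d (T : measurableType d) (R : realType).
Implicit Type mu nu : {sigma_finite_measure set T -> \bar R}.
Local Open Scope ereal_scope.

Lemma ge0_integral_tuple_power0 mu (h : 0.-tuple T -> \bar R) :
  measurable_fun setT h -> (forall t, 0 <= h t) ->
  \int[tuple_power mu 0]_t h t = h [tuple].
Proof. by move=> mh h0; rewrite /= integral_dirac// diracT mul1e. Qed.

Lemma ge0_integral_tuple_powerS mu n (h : n.+1.-tuple T -> \bar R) :
  measurable_fun setT h -> (forall t, 0 <= h t) ->
  \int[tuple_power mu n.+1]_t h t =
  \int[mu]_x \int[tuple_power mu n]_t h (tuple_cons (x, t)).
Proof.
move=> mh h0; have mc := @measurable_tuple_cons d T n.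
rewrite [LHS](@ge0_integral_pushforward _ _ _ _ _ _ mc
  (sigma_finite_product mu (tuple_power mu n))) //=.
by rewrite /sigma_finite_product fubini_tonelli1//; exact: measurableT_comp.
Qed.

Lemma measurable_fun_integral_cons mu n (h : n.+1.-tuple T -> \bar R) :
  measurable_fun setT h -> (forall t, 0 <= h t) ->
  measurable_fun setT (fun x => \int[tuple_power mu n]_t h (tuple_cons (x, t))).
Proof.
move=> mh h0; have mc := @measurable_tuple_cons d T n.
apply: (measurable_fun_fubini_tonelli_F (m2 := tuple_power mu n)
  (h \o @tuple_cons _ T n)) => [|x]; last exact: h0.
exact: measurableT_comp.
Qed.

Lemma measurable_cons_section n (h : n.+1.-tuple T -> \bar R) x :
  measurable_fun setT h -> measurable_fun setT (fun t => h (tuple_cons (x, t))).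
Proof.
move=> mh; apply: (measurableT_comp mh).
apply: (measurableT_comp (@measurable_tuple_cons _ T n)).
exact: pair1_measurable.
Qed.

Lemma measurable_map_tuple n (phi : T -> T) : measurable_fun setT phi ->
  measurable_fun setT (fun t : n.-tuple T => map_tuple phi t).
Proof.
move=> mphi; apply/measurable_fun_tnthP => i.
rewrite (_ : _ \o _ = phi \o (fun t : n.-tuple T => tnth t i)).
  by apply: measurableT_comp => //; exact: measurable_tnth.
by apply/funext => t /=; rewrite tnth_map.
Qed.

Lemma measurable_prod_tnth n (rho : T -> R) : measurable_fun setT rho ->
  measurable_fun setT (fun t : n.-tuple T => (\prod_(i < n) rho (tnth t i))%R).
Proof.
move=> mrho; apply: measurable_prod => i _.
by apply: measurableT_comp => //; exact: measurable_tnth.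
Qed.

(** Induction on n: the one-variable formula handles the head, the induction hypothesis the tail,
    and the densities collect into a product. *)
Lemma ge0_integral_tuple_power_change mu nu (phi : T -> T) (rho : T -> R) :
  measurable_fun setT phi -> measurable_fun setT rho ->
  (forall x, 0 <= rho x)%R ->
  (forall h : T -> \bar R, measurable_fun setT h -> (forall x, 0 <= h x) ->
    \int[mu]_x h x = \int[nu]_x (h (phi x) * (rho x)%:E)) ->
  forall n (h : n.-tuple T -> \bar R),
    measurable_fun setT h -> (forall t, 0 <= h t) ->
    \int[tuple_power mu n]_t h t =
    \int[tuple_power nu n]_t
      (h (map_tuple phi t) * (\prod_(i < n) rho (tnth t i))%:E).
Proof.
move=> mphi mrho rho0 munu.
have mF n (h : n.-tuple T -> \bar R) : measurable_fun setT h ->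
    measurable_fun setT (fun t : n.-tuple T =>
      h (map_tuple phi t) * (\prod_(i < n) rho (tnth t i))%:E).
  move=> mh; apply: emeasurable_funM.
    by apply: (measurableT_comp mh); exact: measurable_map_tuple.
  by apply/measurable_EFinP; exact: measurable_prod_tnth.
have F0 n (h : n.-tuple T -> \bar R) : (forall t, 0 <= h t) ->
    forall t : n.-tuple T,
      0 <= h (map_tuple phi t) * (\prod_(i < n) rho (tnth t i))%:E.
  by move=> h0 t; rewrite mule_ge0// lee_fin prodr_ge0.
elim=> [|n IH] h mh h0.
  rewrite (ge0_integral_tuple_power0 _ mh)//.
  rewrite (ge0_integral_tuple_power0 _ (mF _ _ mh)); last exact: F0.
  by rewrite big_ord0 mule1; congr h; exact: val_inj.
rewrite (ge0_integral_tuple_powerS _ mh)//.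
rewrite (ge0_integral_tuple_powerS _ (mF _ _ mh)); last exact: F0.
rewrite munu; last 2 first.
- exact: measurable_fun_integral_cons.
- by move=> x; exact: integral_ge0.
apply: eq_integral => x _; rewrite IH//; last exact: measurable_cons_section.
rewrite muleC -ge0_integralZl//; last 3 first.
- apply: (mF _ (fun t => h (tuple_cons (phi x, t)))).
  exact: measurable_cons_section.
- by move=> t _; apply: (F0 _ (fun t => h (tuple_cons (phi x, t)))).
- by rewrite lee_fin.
apply: eq_integral => t _.
rewrite big_ord_recl muleCA -EFinM tnth0; congr (h _ * (_ * _)%:E).
  exact: val_inj.
by apply: eq_bigr => i _; rewrite tnthS.
Qed.

End tuple_power_integral.

(** * Scaling of Lebesgue and normal integrals on the line *)

Section gaussian_1d.
Variable R : realType.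
Local Open Scope ereal_scope.

Lemma ge0_integral_real_lebesgue (h : R -> \bar R) :
  measurable_fun setT h -> (forall x, 0 <= h x) ->
  \int[real_lebesgue R]_x h x = \int[lebesgue_measure]_x h x.
Proof.
move=> mh h0.
by rewrite [LHS](@ge0_integral_pushforward _ _ _ _ _ _ (@measurable_to_real R)).
Qed.

(** As with [real_lebesgue], the same set function transported to the canonical measurable structure
    of R, so that [ptws_power] accepts it. *)
Definition real_normal : {sigma_finite_measure set R -> \bar R} :=
  image_measure (@measurable_to_real R) (@measurable_from_real R)
    (fun=> erefl) (normal_prob 0 1).

Lemma real_normalE : real_normal = normal_prob 0 1 :> (set R -> \bar R).
Proof. by []. Qed.

(** Uniqueness of Lebesgue measure: c times its image under x |-> c x gives every interval its
    length. *)
Lemma ge0_integral_lebesgue_scale (c : R) (h : R -> \bar R) : (0 < c)%R ->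
  measurable_fun setT h -> (forall x, 0 <= h x) ->
  \int[lebesgue_measure]_x h x = c%:E * \int[lebesgue_measure]_x h (c * x)%R.
Proof.
move=> c0 mh h0.
pose scale (a x : measurableTypeR R) : measurableTypeR R := (a * x)%R.
have mZ a : measurable_fun setT (scale a) by exact: measurable_funM.
have scaleK : cancel (scale c) (scale c^-1)%R.
  by move=> x; rewrite /scale mulKf// gt_eqF.
have cge0 := ltW c0.
pose k : {nonneg R} := NngNum cge0.
pose nu := image_measure (mZ c) (mZ c^-1)%R scaleK lebesgue_measure.
have E A : measurable A -> lebesgue_measure A = mscale k nu A.
  move=> mA; apply: lebesgue_measure_unique => //= _ [[a b]] _ <-.
  rewrite /mscale /nu /image_measure /pushforward/=.
  have -> : scale c @^-1` [set` `]a, b]] = [set` `](a / c)%R, (b / c)%R]].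
    apply/seteqP; split => x /=; rewrite !in_itv/= /scale.
      by rewrite ltr_pdivrMr// ler_pdivlMr// mulrC.
    by rewrite ltr_pdivrMr// ler_pdivlMr// mulrC.
  rewrite !lebesgue_measure_itv/= !lte_fin ltr_pM2r ?invr_gt0//.
  case: ifP => _; last by rewrite mule0.
  by rewrite -!EFinB -EFinM -mulrBl mulrCA mulfV ?mulr1// gt_eqF.
transitivity (\int[mscale k nu]_x h x).
  by apply: eq_measure_integral => A mA _; exact: E.
rewrite ge0_integral_mscale//.
by rewrite [in LHS](@ge0_integral_pushforward _ _ _ _ _ _ (mZ c)).
Qed.

(** The normal density is inserted and then x is replaced by c x; c will be sqrt(beta) m. *)
Lemma ge0_integral_real_normal (c : R) (h : R -> \bar R) : (0 < c)%R ->
  measurable_fun setT h -> (forall x, 0 <= h x) ->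
  \int[real_normal]_x h x =
  \int[real_lebesgue R]_x (h (c * x)%R * (c * normal_pdf 0 1 (c * x))%:E).
Proof.
move=> c0 mh h0.
have mpdf : measurable_fun [set: R] (normal_pdf 0 1 : R -> R).
  exact: measurable_normal_pdf.
rewrite (@ge0_integral_density _ _ _ (real_lebesgue R) real_normal
  (normal_pdf 0 1))//; last 2 first.
- by move=> x; exact: normal_pdf_ge0.
- move=> A mA.
  have mr : measurable_fun [set: R] ((EFin \o normal_pdf 0 1) \_ A).
    by apply/(measurable_restrictT _ mA)/measurable_EFinP/measurable_funTS.
  rewrite [RHS]integral_mkcond (ge0_integral_real_lebesgue mr).
    by rewrite -integral_mkcond.
  by move=> x; rewrite patchE; case: ifPn => // _; rewrite lee_fin normal_pdf_ge0.
have mhp : measurable_fun setT (fun x => h x * (normal_pdf 0 1 x)%:E).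
  by apply: emeasurable_funM => //; exact/measurable_EFinP.
have hp0 x : 0 <= h x * (normal_pdf 0 1 x)%:E.
  by rewrite mule_ge0// lee_fin normal_pdf_ge0.
have mhc : measurable_fun setT (fun x => h (c * x)%R * (normal_pdf 0 1 (c * x))%:E).
  by apply: (measurableT_comp mhp); exact: measurable_funM.
rewrite (ge0_integral_real_lebesgue mhp)// (ge0_integral_lebesgue_scale c0)//.
under [RHS]eq_integral do rewrite EFinM muleCA.
rewrite ge0_integral_real_lebesgue; last 2 first.
- exact: measurable_funeM.
- by move=> x; rewrite mule_ge0// lee_fin ltW.
by rewrite ge0_integralZl// lee_fin ltW.
Qed.

End gaussian_1d.

(** * Gaussian integrals *)

Section gaussian_integral.
Variable R : realType.

(** The Tonelli order with the head innermost, as needed for integrating one coordinate out by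
    completing the square. *)
Lemma ge0_integral_tuple_powerS_last d (T : measurableType d)
    (mu : {sigma_finite_measure set T -> \bar R}) n (h : n.+1.-tuple T -> \bar R) :
  (measurable_fun setT h -> (forall t, 0 <= h t) ->
  \int[tuple_power mu n.+1]_t h t =
  \int[tuple_power mu n]_t \int[mu]_x h (tuple_cons (x, t)))%E.
Proof.
move=> mh h0; rewrite ge0_integral_tuple_powerS//.
apply: (fubini_tonelli (m1 := mu) (m2 := tuple_power mu n)
  (h \o @tuple_cons _ T n)) => [|x]; last exact: h0.
by apply: (measurableT_comp mh); exact: measurable_tuple_cons.
Qed.

Lemma measurable_gauss_shift (a s : R) :
  measurable_fun setT (fun x : R => expR (- (2^-1 * (a * (x + s) ^+ 2)))).
Proof.
apply: measurableT_comp => //; apply: measurableT_comp => //.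
apply: measurable_funM => //; apply: measurable_funM => //.
by apply: measurable_funX; exact: measurable_funD.
Qed.

Lemma integral_gauss_shift (a s : R) : 0 < a ->
  (\int[real_lebesgue R]_x (expR (- (2^-1 * (a * (x + s) ^+ 2))))%:E =
   (Num.sqrt (2 * pi / a))%:E)%E.
Proof.
move=> a0; have sa0 : 0 < Num.sqrt a by rewrite sqrtr_gt0.
have sa0' : (Num.sqrt a)^-1 != 0 by rewrite invr_eq0 gt_eqF.
have pa0 : 0 < 2 * pi / a by rewrite divr_gt0// mulr_gt0// pi_gt0.
(* The integrand is an unnormalised normal density of mean -s and variance 1 / a. *)
have E x : expR (- (2^-1 * (a * (x + s) ^+ 2))) =
    Num.sqrt (2 * pi / a) * normal_pdf (- s) (Num.sqrt a)^-1 x.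
  rewrite normal_pdfE// /normal_fun /normal_peak ?ltW//.
  rewrite opprK exprVn sqr_sqrtr ?ltW//.
  have -> : a^-1 * pi *+ 2 = 2 * pi / a by rewrite mulrC -mulrnAl mulr_natl.
  rewrite mulVKf ?gt_eqF ?sqrtr_gt0//; congr expR.
  by rewrite -[a^-1 *+ 2]mulr_natr; field; rewrite gt_eqF.
have mpdf : measurable_fun [set: R] (normal_pdf (- s) (Num.sqrt a)^-1 : R -> R).
  exact: measurable_normal_pdf.
under eq_integral do rewrite E EFinM.
have mpdfE : measurable_fun [set: R] (EFin \o normal_pdf (- s) (Num.sqrt a)^-1).
  exact/measurable_EFinP.
have pdf0 x : (0 <= (normal_pdf (- s) (Num.sqrt a)^-1 x)%:E)%E.
  by rewrite lee_fin normal_pdf_ge0.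
rewrite ge0_integralZl// ?lee_fin ?sqrtr_ge0//.
by rewrite (ge0_integral_real_lebesgue mpdfE)//= integral_normal_pdf mule1.
Qed.

Definition quad_form n (A : 'M[R]_n) (t : 'I_n -> R) : R :=
  \sum_i \sum_j A i j * t i * t j.

(** The Schur complement of the corner entry for symmetric A: the first row also stands in for the
    first column. *)
Definition schur n (A : 'M[R]_n.+1) : 'M[R]_n :=
  \matrix_(i, j) (A (lift ord0 i) (lift ord0 j) -
    A ord0 (lift ord0 i) * A ord0 (lift ord0 j) / A ord0 ord0).

(** Block elimination: the unitriangular [L] clears the first column below the corner and leaves the
    Schur complement. *)
Lemma det_schur n (A : 'M[R]_n.+1) : A^T = A -> A ord0 ord0 != 0 ->
  \det A = A ord0 ord0 * \det (schur A).
Proof.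
move=> AT a0; pose A' : 'M[R]_(1 + n) := A.
pose L : 'M[R]_(1 + n) := block_mx 1%:M 0 (- ((A ord0 ord0)^-1 *: dlsubmx A')) 1%:M.
have dL : \det L = 1 by rewrite /L det_lblock !det1 mul1r.
have Asym i j : A i j = A j i by rewrite -[in LHS]AT mxE.
have LA : L *m A' = block_mx (A ord0 ord0)%:M (ursubmx A') 0 (schur A).
  rewrite -{1}(submxK A') /L mulmx_block !mul1mx !mul0mx !addr0.
  congr block_mx.
  - by apply/matrixP => i j; rewrite !ord1 !mxE /= mulr1n; congr (A _ _); exact: val_inj.
  - apply/matrixP => i j; rewrite !mxE big_ord1 !mxE !ord1.
    have -> : lshift n (ord0 : 'I_1) = ord0 by exact: val_inj.
    by rewrite mulNr mulrAC mulVf// mul1r addNr.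
  - apply/matrixP => i j; rewrite !mxE big_ord1 !mxE.
    have -> : lshift n (ord0 : 'I_1) = ord0 by exact: val_inj.
    rewrite !rshift1 (Asym (lift _ _) ord0); rewrite addrC; congr (_ + _).
    by field.
have <- : \det (L *m A') = \det A by rewrite det_mulmx dL mul1r.
by rewrite LA det_ublock det_scalar1.
Qed.

(** Completing the square in the head variable; the [unlift] expression is the vector with head x
    and tail t. *)
Lemma quad_form_schur n (A : 'M[R]_n.+1) (x : R) (t : 'I_n -> R) :
  A^T = A -> A ord0 ord0 != 0 ->
  quad_form A (fun i => if unlift ord0 i is Some j then t j else x) =
  A ord0 ord0 * (x + (\sum_j A ord0 (lift ord0 j) * t j) / A ord0 ord0) ^+ 2 +
  quad_form (schur A) t.
Proof.
move=> AT a0; set a := A ord0 ord0; set b := \sum_j A ord0 (lift ord0 j) * t j.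
have Asym i j : A i j = A j i by rewrite -[in LHS]AT mxE.
rewrite /quad_form big_ord_recl big_ord_recl !unlift_none.
under eq_bigr do rewrite liftK.
have -> : \sum_(i < n) A ord0 (lift ord0 i) * x * t i = x * b.
  by rewrite /b mulr_sumr; apply: eq_bigr => i _; rewrite mulrAC mulrC.
under [X in _ + _ + X]eq_bigr => i _.
  rewrite big_ord_recl liftK unlift_none.
  under eq_bigr => j _ do rewrite liftK.
  rewrite Asym; over.
rewrite big_split /=.
have -> : \sum_(i < n) A ord0 (lift ord0 i) * t i * x = b * x.
  by rewrite /b mulr_suml.
have -> : \sum_i \sum_j schur A i j * t i * t j =
    \sum_i \sum_j A (lift ord0 i) (lift ord0 j) * t i * t j - b ^+ 2 / a.
  rewrite expr2 {1}/b -mulrA mulr_suml -sumrB; apply: eq_bigr => i _.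
  rewrite /b mulr_suml mulr_sumr -sumrB; apply: eq_bigr => j _.
  by rewrite mxE -/a; field.
rewrite -/a; move: (\sum_i \sum_j _) a0 => q; rewrite -/a; clearbody a b => a0.
by field; exact: a0.
Qed.

Definition pos_def n (A : 'M[R]_n) : Prop :=
  forall t : 'I_n -> R, (exists i, t i != 0) -> 0 < quad_form A t.

Lemma measurable_quad_form n (A : 'M[R]_n) :
  measurable_fun setT (fun t : n.-tuple R => quad_form A (tnth t)).
Proof.
apply: measurable_sum => i; apply: measurable_sum => j.
by apply: measurable_funM; [apply: measurable_funM => //|]; exact: measurable_tnth.
Qed.

(** Positivity of the determinant travels with the induction, since the formula divides by the
    determinant of the Schur complement. *)
Lemma gaussian_integral n (A : 'M[R]_n) : A^T = A -> pos_def A ->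
  0 < \det A /\
  (\int[tuple_power (real_lebesgue R) n]_t (expR (- (2^-1 * quad_form A (tnth t))))%:E =
  (Num.sqrt ((2 * pi) ^+ n / \det A))%:E)%E.
Proof.
have mE k (B : 'M[R]_k) : measurable_fun [set: k.-tuple R]
    (fun t => (expR (- (2^-1 * quad_form B (tnth t))))%:E).
  apply/measurable_EFinP; apply: measurableT_comp => //.
  by apply: measurableT_comp => //; apply: measurable_funM => //; exact: measurable_quad_form.
have E0 k (B : 'M[R]_k) t : (0 <= (expR (- (2^-1 * quad_form B (tnth t))))%:E)%E.
  by rewrite lee_fin expR_ge0.
elim: n A => [|n IH] A AT pdA.
  rewrite det_mx00; split => //.
  rewrite ge0_integral_tuple_power0// /quad_form big_ord0 mulr0 oppr0 expR0.
  by rewrite expr0 divr1 sqrtr1.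
pose a := A ord0 ord0.
have consE (x : R) (t : 'I_n -> R) : 0 < a ->
  quad_form A (fun i => if unlift ord0 i is Some j then t j else x) =
  a * (x + (\sum_j A ord0 (lift ord0 j) * t j) / a) ^+ 2 + quad_form (schur A) t.
  by move=> a0; rewrite quad_form_schur// gt_eqF.
(* Positive definiteness is tested on the first unit vector. *)
have a0 : 0 < a.
  have := pdA (fun i => (i == ord0)%:R); rewrite /quad_form big_ord_recl big_ord_recl.
  rewrite eqxx !mulr1 !big1 ?addr0; first by apply; exists ord0; rewrite eqxx oner_eq0.
    by move=> i _; rewrite big1// => j _; rewrite -[lift _ _ == _]/false mulr0 mul0r.
  by move=> i _; rewrite -[lift _ _ == _]/false mulr0.
have ST : (schur A)^T = schur A.
  have Asym i j : A i j = A j i by rewrite -[in LHS]AT mxE.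
  apply/matrixP => i j; rewrite !mxE Asym; congr (_ - _ / _).
  by rewrite mulrC.
have pdS : pos_def (schur A).
  move=> t [i ti].
  (* This head value makes the completed square vanish, leaving only the form of the Schur
     complement. *)
  have := consE (- ((\sum_j A ord0 (lift ord0 j) * t j) / a)) t a0.
  rewrite addNr expr0n mulr0 add0r => <-; apply: pdA.
  by exists (lift ord0 i); rewrite liftK.
have [dS IHS] := IH _ ST pdS.
have dA : \det A = a * \det (schur A) by rewrite det_schur// gt_eqF.
split; first by rewrite dA mulr_gt0.
rewrite ge0_integral_tuple_powerS_last//.
under eq_integral => t _.
  under eq_integral => x _.
    have -> : tnth (tuple_cons (x, t)) =
        (fun i => if unlift ord0 i is Some j then tnth t j else x).
      apply/funext => i; case: (unliftP ord0 i) => [j|] ->; first by rewrite tnthS.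
      by rewrite tnth0.
    rewrite (consE _ _ a0) mulrDr opprD expRD mulrC EFinM; over.
  rewrite /= ge0_integralZl//; last first.
    apply/measurable_EFinP. exact: measurable_gauss_shift.
  rewrite integral_gauss_shift// muleC; over.
rewrite /= ge0_integralZl// ?lee_fin ?sqrtr_ge0//; last exact: mE.
rewrite IHS -EFinM -sqrtrM.
  by rewrite dA exprS; congr (Num.sqrt _)%:E; field; rewrite !gt_eqF.
by rewrite ltW// divr_gt0// mulr_gt0// pi_gt0.
Qed.

End gaussian_integral.

(** * The Dirichlet form of the Hamming graph *)

Section dirichlet_form.
Variables (R : realType) (d n' : nat) (J : nat -> R).
Local Notation n := n'.+1.
Implicit Types (x y : vertex d n) (v : vertex d n -> R).

(** Extending J by 0 outside 1..d lets sums over the relations become sums over all ordered pairs of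
    vertices. *)
Definition coupling (j : nat) : R := if (0 < j <= d)%N then J j else 0.

Definition total_coupling : R := \sum_(1 <= j < d.+1) (kappa d n j)%:R * J j.

Definition dirichlet v : R :=
  \sum_x \sum_y coupling (hdist x y) * (v x - v y) ^+ 2.

(* The entry of I - P + m2 at two vertices at distance j. *)
Definition massive_kernel (m2 : R) (j : nat) : R :=
  (j == 0%N)%:R * (total_coupling + m2) - coupling j.

Lemma hdistC x y : hdist x y = hdist y x.
Proof. by rewrite !hdistE; apply: eq_bigr => i _; rewrite eq_sym. Qed.

Lemma hdist_eq0 x y : (hdist x y == 0%N) = (x == y).
Proof.
apply/idP/eqP => [|->]; last by rewrite hdistE big1// => i _; rewrite eqxx.
rewrite hdistE sum_nat_eq0 => /forallP H; apply/ffunP => i.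
by have := H i; rewrite implyTb eqb0 negbK => /eqP.
Qed.

Lemma coupling0 : coupling 0 = 0. Proof. by []. Qed.

Lemma sum_coupling (F : nat -> R) :
  \sum_(0 <= j < d.+1) coupling j * F j = \sum_(1 <= j < d.+1) J j * F j.
Proof.
rewrite big_ltn// coupling0 mul0r add0r; apply: eq_big_nat => j.
by rewrite /coupling ltnS => ->.
Qed.

Lemma sum_hrel (F : vertex d n -> vertex d n -> R) :
  \sum_(1 <= i < d.+1) J i * \sum_(p in hrel d n i) F p.1 p.2 =
  \sum_x \sum_y coupling (hdist x y) * F x y.
Proof.
under [RHS]eq_bigr => x _ do rewrite (sum_hdist coupling (F x)) sum_coupling.
rewrite exchange_big/=; apply: eq_bigr => i _; rewrite -mulr_sumr.
rewrite pair_big_dep/=; congr (_ * _); apply: eq_bigl => p.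
by rewrite inE.
Qed.

Lemma hamiltonian_dirichlet (m : R) (xi : vertex d n -> R) :
  hamiltonian J m xi = 4^-1 * dirichlet xi + m ^+ 2 / 2 * \sum_x xi x ^+ 2.
Proof. by rewrite /hamiltonian (sum_hrel (fun x y => (xi x - xi y) ^+ 2)). Qed.

Lemma sum_coupling_hdist x : \sum_y coupling (hdist x y) = total_coupling.
Proof.
under eq_bigr do rewrite -[coupling _]mulr1.
rewrite (sum_hdist coupling (fun=> 1)) sum_coupling; apply: eq_big_nat => j.
rewrite ltnS => /andP[_ jd].
by rewrite -(card_hdist R x jd) natr_sum mulrC.
Qed.

(** Expanding the square gives two equal diagonal sums, by symmetry of the distance, and a cross
    term. The parenthesis on the right is (I - P) v at x. *)
Lemma dirichletE v : dirichlet v =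
  2 * \sum_x v x * (total_coupling * v x - \sum_y coupling (hdist x y) * v y).
Proof.
pose A := \sum_x \sum_y coupling (hdist x y) * v x ^+ 2.
pose B := \sum_x \sum_y coupling (hdist x y) * v y ^+ 2.
pose C := \sum_x \sum_y coupling (hdist x y) * (v x * v y).
have AE : A = \sum_x total_coupling * v x ^+ 2.
  by apply: eq_bigr => x _; rewrite -mulr_suml sum_coupling_hdist.
have BA : B = A.
  rewrite /B exchange_big; apply: eq_bigr => x _; apply: eq_bigr => y _.
  by rewrite hdistC.
have -> : dirichlet v = A + B - 2 * C.
  rewrite /A /B /C mulr_sumr -big_split -sumrB; apply: eq_bigr => x _.
  rewrite mulr_sumr -big_split -sumrB; apply: eq_bigr => y _.
  by rewrite /=; ring.
have -> : \sum_x v x * (total_coupling * v x - \sum_y coupling (hdist x y) * v y)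
    = A - C.
  rewrite AE /C -sumrB; apply: eq_bigr => x _.
  rewrite mulrBr; congr (_ - _); first by rewrite expr2 mulrCA.
  by rewrite mulr_sumr; apply: eq_bigr => y _; rewrite mulrCA.
by rewrite BA; ring.
Qed.

Lemma sum_massive_kernel (m2 : R) v x :
  \sum_y massive_kernel m2 (hdist x y) * v y =
  (total_coupling + m2) * v x - \sum_y coupling (hdist x y) * v y.
Proof.
under eq_bigr do rewrite /massive_kernel mulrBl hdist_eq0.
rewrite sumrB; congr (_ - _); rewrite (bigD1 x)//= eqxx mul1r big1 ?addr0//.
by move=> y; rewrite eq_sym => /negPf ->; rewrite mul0r mul0r.
Qed.

Lemma hamiltonianE (m : R) (xi : vertex d n -> R) : hamiltonian J m xi =
  2^-1 * \sum_x xi x * \sum_y massive_kernel (m ^+ 2) (hdist x y) * xi y.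
Proof.
rewrite hamiltonian_dirichlet dirichletE.
have -> : \sum_x xi x * \sum_y massive_kernel (m ^+ 2) (hdist x y) * xi y =
    \sum_x xi x * (total_coupling * xi x - \sum_y coupling (hdist x y) * xi y) +
    m ^+ 2 * \sum_x xi x ^+ 2.
  rewrite mulr_sumr -big_split; apply: eq_bigr => x _.
  by rewrite sum_massive_kernel /=; ring.
by field.
Qed.

Lemma quad_form_radial_mx (G : nat -> R) (xi : vertex d n -> R) :
  quad_form (radial_mx d n' G) (fun i => xi (enum_val i)) =
  \sum_x xi x * \sum_y G (hdist x y) * xi y.
Proof.
have sum_val (F : vertex d n -> R) :
    \sum_(a < #|vertex d n|) F (enum_val a) = \sum_x F x.
  by rewrite [RHS](reindex _ (onW_bij _ (enum_val_bij (vertex d n)))).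
rewrite -sum_val; apply: eq_bigr => i _; rewrite -sum_val mulr_sumr.
by apply: eq_bigr => j _; rewrite mxE; ring.
Qed.

Hypothesis J_ge0 : forall i, (1 <= i <= d)%N -> 0 <= J i.

Lemma coupling_ge0 j : 0 <= coupling j.
Proof. by rewrite /coupling; case: ifP => // /J_ge0. Qed.

Lemma dirichlet_ge0 v : 0 <= dirichlet v.
Proof.
apply: sumr_ge0 => x _; apply: sumr_ge0 => y _.
by rewrite mulr_ge0 ?coupling_ge0// sqr_ge0.
Qed.

(** A vanishing sum of nonnegative terms has only zero terms. *)
Lemma dirichlet_eq0 v x y : dirichlet v = 0 -> coupling (hdist x y) != 0 ->
  v x = v y.
Proof.
have t0 z w : 0 <= coupling (hdist z w) * (v z - v w) ^+ 2.
  by rewrite mulr_ge0 ?coupling_ge0// sqr_ge0.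
move=> D0 c0; have /(_ x isT) : forall z, true ->
    \sum_w coupling (hdist z w) * (v z - v w) ^+ 2 = 0.
  by apply: psumr_eq0P => // z _; exact: sumr_ge0.
move=> /psumr_eq0P => /(_ (fun w _ => t0 x w) y isT) /eqP.
by rewrite mulf_eq0 (negPf c0)/= sqrf_eq0 subr_eq0 => /eqP.
Qed.

Hypothesis n'_gt0 : (0 < n')%N.

Lemma kappa_gt0 i : (i <= d)%N -> (0 < kappa d n i)%N.
Proof. by move=> id; rewrite /kappa muln_gt0 bin_gt0 id subn1 expn_gt0 n'_gt0. Qed.

(** This is the entry of P at distance j: since n >= 2, kappa_j is positive and cancels, leaving J_j
    off the diagonal. *)
Lemma weight_coupling j : (j <= d)%N ->
  weight d n J j / (kappa d n j)%:R =
  (j == 0%N)%:R * (1 - total_coupling) + coupling j.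
Proof.
move=> jd; rewrite /weight; case: eqP => [->|/eqP j0].
  by rewrite /kappa bin0 expn0 coupling0 divr1 mul1r addr0.
rewrite mul0r add0r /coupling lt0n j0 jd/= mulrAC divff ?mul1r//.
by rewrite pnatr_eq0 -lt0n kappa_gt0.
Qed.

Lemma krawtchouk0 i : (i <= d)%N -> krawtchouk d n R 0 i = 1.
Proof.
move=> id; rewrite /krawtchouk add0n min0n (eqP id) big_nat1.
by rewrite subnn !expr0 !bin0 !mulr1.
Qed.

Lemma eigenval_coupling i : (i <= d)%N -> eigenval d n J i =
  1 - total_coupling + \sum_(0 <= j < d.+1) coupling j * krawtchouk d n R j i.
Proof.
move=> id; rewrite /eigenval.
under eq_big_nat => j /andP[_ jd].
  rewrite weight_coupling// mulrDl; over.
rewrite big_split/=; congr (_ + _).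
rewrite big_ltn// eqxx mul1r krawtchouk0// mulr1 big_nat_cond big1 ?addr0//.
by move=> j /andP[/andP[j0 _] _]; rewrite gtn_eqF// !mul0r.
Qed.

Lemma radial_eigenval_massive (m2 : R) i : (i <= d)%N ->
  radial_eigenval d n' (massive_kernel m2) i = 1 + m2 - eigenval d n J i.
Proof.
move=> id; rewrite /radial_eigenval eigenval_coupling//.
under eq_bigr do rewrite /massive_kernel mulrBl.
rewrite sumrB big_ltn// eqxx mul1r krawtchouk0// mulr1.
rewrite [X in _ + X - _]big_nat_cond [X in _ + X - _]big1 ?addr0; first by ring.
by move=> j /andP[/andP[j0 _] _]; rewrite gtn_eqF// !mul0r.
Qed.

(** K_j(0) = kappa_j, so lambda_0 is the row sum of P. *)
Lemma eigenval0 : eigenval d n J 0 = 1.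
Proof.
rewrite eigenval_coupling// sum_coupling /total_coupling.
rewrite [X in _ + X](_ : _ = \sum_(1 <= j < d.+1) (kappa d n j)%:R * J j) ?subrK//.
apply: eq_big_nat => j; rewrite ltnS => /andP[_ jd].
rewrite krawtchoukE// expr0 mul1r subn0 coef_linear_exp.
by rewrite /kappa subn1/= natrM natrX; ring.
Qed.

Lemma basis_diag (k : vertex d n) : tensor_basis R k k = 1.
Proof.
rewrite /tensor_basis big1// => i _; rewrite /basis1; case: ifP => // ->.
by rewrite eqxx subr0.
Qed.

(** [massive_kernel] at mass 0 is the kernel of I - P, for which the basis function is an
    eigenvector with eigenvalue 1 - lambda. *)
Lemma dirichlet_basis (k : vertex d n) : dirichlet (tensor_basis R k) =
  2 * (1 - eigenval d n J (hdist (zvertex d n') k)) * \sum_x tensor_basis R k x ^+ 2.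
Proof.
rewrite dirichletE -mulrA; congr (_ * _); rewrite mulr_sumr; apply: eq_bigr => x _.
have kd := hdist_le (zvertex d n') k.
have := radial_eigenval_massive 0 kd; rewrite addr0 => <-.
have := sum_massive_kernel 0 (tensor_basis R k) x; rewrite addr0 => <-.
by rewrite radial_basis; ring.
Qed.

Lemma sum_sqr_basis_gt0 (k : vertex d n) : 0 < \sum_x tensor_basis R k x ^+ 2.
Proof.
rewrite (bigD1 k)//= basis_diag expr1n ltr_pwDl// sumr_ge0// => x _.
exact: sqr_ge0.
Qed.

Lemma exists_hdist i : (i <= d)%N -> exists k, hdist (zvertex d n') k = i.
Proof.
move=> id; have := kappa_gt0 id; rewrite -(card_hdist R (zvertex d n') id).
rewrite lt0n sum_nat_eq0 negb_forall => /existsP[k].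
by rewrite negb_imply => /andP[/eqP ? _]; exists k.
Qed.

Lemma eigenval_le1 i : (i <= d)%N -> eigenval d n J i <= 1.
Proof.
move=> /exists_hdist[k <-].
have := dirichlet_ge0 (tensor_basis R k); rewrite dirichlet_basis.
by rewrite pmulr_lge0 ?sum_sqr_basis_gt0// pmulr_rge0// subr_ge0.
Qed.

(** If lambda_i = 1, a basis function of that eigenvalue has zero Dirichlet form, hence is constant
    along the edges of P and, by irreducibility, everywhere. It nevertheless takes the values 1 and
    -1. *)
Lemma eigenval_lt1 i : irreducible_mx (transition d n J) -> (1 <= i <= d)%N ->
  eigenval d n J i < 1.
Proof.
move=> irr /andP[i1 id]; rewrite lt_neqAle eigenval_le1// andbT.
have [k ki] := exists_hdist id; apply/eqP => ei.
have D0 : dirichlet (tensor_basis R k) = 0.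
  by rewrite dirichlet_basis ki ei subrr mulr0 mul0r.
(* A nonzero entry of a power of P forces a path: some intermediate vertex contributes a nonzero
   product. *)
have step t a b : (transition d n J ^+ t) a b != 0 ->
    tensor_basis R k (enum_val a) = tensor_basis R k (enum_val b).
  elim: t a b => [|t IH] a b.
    rewrite expr0 -[1]/(1%:M) mxE; by case: (eqVneq a b) => [->//|_]; rewrite eqxx.
  rewrite exprS mxE => S0.
  have [c] : exists c, transition d n J a c * (transition d n J ^+ t) c b != 0.
    apply: contrapT => /forallNP H; move: S0; rewrite big1 ?eqxx// => c _.
    by apply/eqP; have /negP := H c; rewrite negbK.
  rewrite mulf_eq0 negb_or => /andP[ac cb]; rewrite -(IH _ _ cb).
  move: ac; rewrite mxE weight_coupling ?hdist_le// hdist_eq0.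
  case: (eqVneq (enum_val a) (enum_val c)) => [->//|_]; rewrite mul0r add0r.
  exact: dirichlet_eq0.
have const x y : tensor_basis R k x = tensor_basis R k y.
  have [t xy] := irr (enum_rank x) (enum_rank y).
  by have := step t (enum_rank x) (enum_rank y); rewrite gt_eqF// !enum_rankK; apply.
have [j kj] : exists j, k j != ord0.
  have : hdist (zvertex d n') k != 0%N by rewrite ki -lt0n.
  rewrite hdistE sum_nat_eq0 negb_forall => /existsP[j].
  rewrite implyTb eqb0 negbK ffunE => H; by exists j; rewrite eq_sym.
(* Resetting one nonzero coordinate of k to 0 turns its factor from 1 into -1. *)
pose k' : vertex d n := [ffun l => if l == j then ord0 else k l].
have := const k k'; rewrite basis_diag /tensor_basis (bigD1 j)//= /k' ffunE eqxx.
rewrite big1 => [|l lj].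
  rewrite /basis1 (negPf kj) eqxx eq_sym (negPf kj) sub0r mulr1 => /eqP.
  by rewrite -subr_eq0 opprK paddr_eq0 ?ler01// oner_eq0.
rewrite ffunE (negPf lj) /basis1; case: ifP => // ->.
by rewrite eqxx subr0.
Qed.

(** The form is 2 beta times the Hamiltonian: the Dirichlet part is nonnegative and the mass term is
    positive on nonzero vectors. *)
Lemma massive_pos_def (beta m : R) : 0 < beta -> 0 < m ->
  pos_def (radial_mx d n' (fun j => beta * massive_kernel (m ^+ 2) j)).
Proof.
move=> b0 m0 t [i ti].
pose xi (x : vertex d n) := t (enum_rank x).
have -> : t = (fun i => xi (enum_val i)).
  by apply/funext => a; rewrite /xi enum_valK.
rewrite quad_form_radial_mx.
have -> : \sum_x xi x * \sum_y beta * massive_kernel (m ^+ 2) (hdist x y) * xi y =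
    beta * 2 * hamiltonian J m xi.
  rewrite hamiltonianE mulrA -[_ * 2 / 2]mulrA divff ?mulr1//.
  rewrite mulr_sumr; apply: eq_bigr => x _; rewrite mulrCA; congr (_ * _).
  by rewrite mulr_sumr; apply: eq_bigr => y _; rewrite mulrA.
rewrite hamiltonian_dirichlet mulr_gt0// ?mulr_gt0//.
rewrite ltr_wpDl// ?mulr_ge0 ?dirichlet_ge0//.
rewrite mulr_gt0// ?divr_gt0// ?exprn_gt0//.
rewrite (bigD1 (enum_val i))//= ltr_pwDl//.
  by rewrite /xi enum_valK exprn_even_gt0.
by apply: sumr_ge0 => x _; exact: sqr_ge0.
Qed.

Lemma radial_mx_sym (G : nat -> R) :
  (radial_mx d n' G)^T = radial_mx d n' G.
Proof. by apply/matrixP => a b; rewrite !mxE hdistC. Qed.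

End dirichlet_form.

(** * The large-mass limit *)

Section ptws_measurable.
Variables (R : realType) (X : finType).

Lemma cvg_ptws (I : Type) (F : set_system I) (g : I -> {ptws X -> R})
    (f : {ptws X -> R}) : Filter F ->
  (forall x, g i x @[i --> F] --> f x) -> g @ F --> f.
Proof.
move=> FF gf; apply/cvg_sup => x; rewrite cvg_image; last first.
  (* [cvg_image] asks for a surjective evaluation; constant functions reach every value. *)
  by rewrite eqEsubset; split => // r _; exists (fun=> r).
move=> A /gf Ax; exists ((fun h : X -> R => h x) @^-1` A) => //.
rewrite eqEsubset; split => [_ [h Ah <-]//|r Ar].
by exists (fun=> r).
Qed.

Lemma measurable_ptws_box (A : X -> set R) : (forall x, measurable (A x)) ->
  measurable [set xi : {ptws X -> R} | forall x, A x (xi x)].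
Proof.
move=> mA; rewrite (_ : [set xi | _] = \bigcap_(x in [set: X])
    ((fun xi : {ptws X -> R} => xi x) @^-1` A x)); last first.
  by apply/seteqP; split => xi /= H x => [_|]; exact: H.
apply: fin_bigcap_measurable => // x _; rewrite -[X in measurable X]setTI.
exact: measurable_ptws_eval.
Qed.

(* f \o grid_round k factors through a countable discrete set of cells, so it is
   measurable for the product sigma-algebra whatever f is. *)
Definition grid_round (k : nat) (xi : {ptws X -> R}) : {ptws X -> R} :=
  fun x => (Num.floor (k.+1%:R * xi x))%:~R / k.+1%:R.

Lemma cvg_grid_round (xi : {ptws X -> R}) : grid_round k xi @[k --> \oo] --> xi.
Proof.
apply: cvg_ptws => x.
have inv0 : (xi x - k.+1%:R^-1) @[k --> \oo] --> xi x.
  rewrite -[X in _ --> X]subr0; apply: cvgB; first exact: cvg_cst.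
  exact: cvg_harmonic.
apply: (squeeze_cvgr _ inv0 (cvg_cst (xi x))).
apply: nearW => k; have /andP[lo hi] := Num.Theory.floor_itv (k.+1%:R * xi x).
have k0 : 0 < k.+1%:R :> R by [].
rewrite /grid_round ler_pdivrMr// (mulrC (xi x)) lo andbT.
rewrite ler_pdivlMr// mulrBl mulVf ?gt_eqF//.
by move: hi; rewrite intrD mulrC; lra.
Qed.

(** f is the pointwise limit of f composed with [grid_round k], and preimages under the latter are
    countable unions of boxes. *)
Lemma measurable_continuous_ptws (f : {ptws X -> R} -> R) :
  continuous f -> measurable_fun setT f.
Proof.
move=> cf; apply: (@measurable_fun_cvg _ _ _ _ (fun k => f \o grid_round k)); last first.
  move=> xi _; have cfx : f y @[y --> (xi : {ptws X -> R})] --> f xi by exact: cf.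
  exact: (cvg_comp _ _ (@cvg_grid_round xi) cfx).
move=> k _ B mB; rewrite setTI.
pose pt (c : {ffun X -> int}) : {ptws X -> R} := fun x => (c x)%:~R / k.+1%:R.
(* The grid cell with corner [pt c], made empty unless f maps that corner into B. *)
pose box (c : {ffun X -> int}) : set {ptws X -> R} :=
  [set xi | f (pt c) \in B /\
     forall x, [set` `[(c x)%:~R / k.+1%:R, (c x + 1)%:~R / k.+1%:R[] (xi x)].
have -> : (f \o grid_round k) @^-1` B = \bigcup_c box c.
  have k0 : 0 < k.+1%:R :> R by [].
  apply/seteqP; split => xi /=.
    move=> Bxi; exists [ffun x => Num.floor (k.+1%:R * xi x)] => //; split.
      rewrite inE; move: Bxi; congr (B (f _)).
      by apply/funext => x; rewrite /pt ffunE.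
    move=> x; rewrite ffunE /= in_itv/=.
    by rewrite ler_pdivrMr// ltr_pdivlMr// mulrC Num.Theory.floor_itv.
  move=> [c _ [/set_mem Bc bc]]; move: Bc; congr (B (f _)).
  apply/funext => x; rewrite /pt /grid_round; congr (_%:~R / _).
  apply/esym/Num.Theory.floor_def; have := bc x; rewrite /= in_itv/=.
  by rewrite ler_pdivrMr// ltr_pdivlMr// mulrC.
apply: countable_bigcupT_measurable; first exact: countableP.
move=> c; rewrite /box; case: (boolP (f (pt c) \in B)) => Bc.
  rewrite (_ : [set xi | _] = [set xi : {ptws X -> R} | forall x,
      [set` `[(c x)%:~R / k.+1%:R, (c x + 1)%:~R / k.+1%:R[] (xi x)]).
    have := @measurable_ptws_box (fun x =>
      [set` `[(c x)%:~R / k.+1%:R, (c x + 1)%:~R / k.+1%:R[]).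
    by apply=> x; exact: measurable_itv.
  by apply/seteqP; split => xi /=; [case|split].
by rewrite (_ : [set xi | _] = set0)//; apply/seteqP; split => xi //= [].
Qed.

End ptws_measurable.

(** * The standard Gaussian measure on R^X *)

Section gaussian_field.
Variables (R : realType) (X : finType).
Local Notation RX := {ptws X -> R}.

Lemma ge0_integral_ptws_power (mu : {sigma_finite_measure set R -> \bar R})
    (h : RX -> \bar R) : measurable_fun setT h -> (forall xi, 0 <= h xi)%E ->
  (\int[ptws_power X mu]_xi h xi =
   \int[tuple_power mu #|X|]_t h (ptws_of_tuple t))%E.
Proof.
move=> mh h0.
by rewrite [LHS](@ge0_integral_pushforward _ _ _ _ _ _
  (@measurable_ptws_of_tuple _ R X)).
Qed.

Definition gaussian_field : set RX -> \bar R := ptws_power X (real_normal R).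

HB.instance Definition _ := Measure.on gaussian_field.

Let gaussian_field_setT : gaussian_field setT = 1%E.
Proof.
have -> : [set: RX] = [set xi | forall x, [set: R] (xi x)] by apply/seteqP.
rewrite /gaussian_field (ptws_power_rect _ (A := fun=> setT))// big1// => x _.
by rewrite real_normalE probability_setT.
Qed.

HB.instance Definition _ :=
  Measure_isProbability.Build _ _ _ gaussian_field gaussian_field_setT.

Lemma measurable_scale_ptws (c : R) :
  measurable_fun setT (fun xi : RX => (fun x => c * xi x) : RX).
Proof.
apply: measurable_ptws => x; apply: measurable_funM => //.
exact: measurable_ptws_eval.
Qed.

Lemma measurable_sum_sqr : measurable_fun setT (fun xi : RX => \sum_x xi x ^+ 2).
Proof.
by apply: measurable_sum => x; apply: measurable_funX; exact: measurable_ptws_eval.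
Qed.

(** The substitution eta = c xi in every coordinate; each contributes a factor c / sqrt(2 pi) and a
    Gaussian weight. *)
Lemma ge0_integral_gaussian_field (c : R) (h : RX -> \bar R) : 0 < c ->
  measurable_fun setT h -> (forall xi, 0 <= h xi)%E ->
  (\int[gaussian_field]_xi h xi =
   ((c / Num.sqrt (2 * pi)) ^+ #|X|)%:E *
   \int[ptws_lebesgue R X]_xi
     (h (fun x => c * xi x)%R * (expR (- (c ^+ 2 / 2 * \sum_x xi x ^+ 2)))%:E))%E.
Proof.
move=> c0 mh h0.
have K0 : 0 < (c / Num.sqrt (2 * pi)) ^+ #|X|.
  by rewrite exprn_gt0// divr_gt0// sqrtr_gt0 mulr_gt0// pi_gt0.
have mF : measurable_fun setT (fun xi : RX => (h (fun x => c * xi x)%R *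
    (expR (- (c ^+ 2 / 2 * \sum_x xi x ^+ 2)))%:E)%E).
  apply: emeasurable_funM.
    by apply: (measurableT_comp mh); exact: measurable_scale_ptws.
  apply/measurable_EFinP; apply: measurableT_comp => //.
  apply: measurableT_comp => //; apply: measurable_funM => //.
  exact: measurable_sum_sqr.
have F0 xi : (0 <= h (fun x => c * xi x)%R *
    (expR (- (c ^+ 2 / 2 * \sum_x xi x ^+ 2)))%:E)%E.
  by rewrite mule_ge0// lee_fin expR_ge0.
rewrite -ge0_integralZl//; last by rewrite lee_fin ltW.
rewrite [LHS]ge0_integral_ptws_power//.
rewrite [RHS]ge0_integral_ptws_power//; last 2 first.
- by apply: measurable_funeM.
- by move=> xi; rewrite mule_ge0// lee_fin ltW.
have mpdf : measurable_fun [set: R] (fun x => c * normal_pdf 0 1 (c * x)).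
  apply: measurable_funM => //; apply: (measurableT_comp (measurable_normal_pdf 0 1)).
  exact: measurable_funM.
have mZ : measurable_fun [set: R] (fun x => c * x) by exact: measurable_funM.
have pdf0 x : 0 <= c * normal_pdf 0 1 (c * x).
  by rewrite mulr_ge0 ?normal_pdf_ge0// ltW.
have mht : measurable_fun setT (h \o @ptws_of_tuple _ R X).
  by apply: (measurableT_comp mh); exact: measurable_ptws_of_tuple.
rewrite (ge0_integral_tuple_power_change mZ mpdf pdf0
  (fun k => @ge0_integral_real_normal R c k c0) mht)//=.
apply: eq_integral => t _; rewrite muleCA -EFinM; congr (h _ * _%:E)%E.
  by apply/funext => x; rewrite /ptws_of_tuple tnth_map.
have -> : \sum_x ptws_of_tuple t x ^+ 2 = \sum_(i < #|X|) tnth t i ^+ 2.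
  rewrite (reindex _ (onW_bij _ (enum_val_bij X)))/=.
  by apply: eq_bigr => i _; rewrite /ptws_of_tuple enum_valK.
rewrite mulr_sumr -sumrN expR_sum -[X in _ ^+ X]card_ord -prodr_const -big_split.
apply: eq_bigr => i _; rewrite normal_pdfE ?oner_eq0//= /normal_peak /normal_fun.
rewrite expr1n mul1r subr0 -mulr_natl mulrA; congr (_ * expR _).
by rewrite exprMn; field.
Qed.

(** The hypothesis says that the joint law of g, formed as the distribution of the packed vector
    [G'], has density rho. *)
Lemma ge0_integral_law (rho : RX -> R) d (Om : measurableType d)
    (P : probability Om R) (g : X -> {RV P >-> R}) (h : RX -> \bar R) :
  (forall xi, 0 <= rho xi) -> measurable_fun setT rho ->
  (forall A : set RX, measurable A -> P [set w | A (fun x => g x w)] =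
     \int[ptws_lebesgue R X]_(xi in A) (rho xi)%:E)%E ->
  measurable_fun setT h -> (forall xi, 0 <= h xi)%E ->
  (\int[P]_w h (fun x => g x w) =
   \int[ptws_lebesgue R X]_xi (h xi * (rho xi)%:E))%E.
Proof.
move=> rho0 mrho law mh h0.
pose G w : RX := fun x => g x w.
have mG : measurable_fun setT G by apply: measurable_ptws => x.
pose G' : {mfun Om >-> RX} := HB.pack G (isMeasurableFun.Build _ _ _ _ _ mG).
rewrite -(@ge0_integral_density _ _ _ (ptws_lebesgue R X) (distribution P G') rho)//.
by rewrite [RHS](@ge0_integral_pushforward _ _ _ _ _ _ mG).
Qed.

Definition coordinate (x : X) (xi : RX) : R := xi x.

Lemma measurable_coordinate x : measurable_fun setT (coordinate x).
Proof. exact: measurable_ptws_eval. Qed.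

HB.instance Definition _ x :=
  isMeasurableFun.Build _ _ _ _ (coordinate x) (measurable_coordinate x).

Lemma gaussian_field_rect (S : {set X}) (B : X -> set R) :
  (forall x, measurable (B x)) ->
  gaussian_field [set xi | forall x, x \in S -> B x (xi x)] =
  (\prod_(x in S) normal_prob 0 1 (B x))%E.
Proof.
(* Coordinates outside S are left free, which costs a factor of total mass 1. *)
move=> mB; pose A x := if x \in S then B x else setT.
have -> : [set xi : RX | forall x, x \in S -> B x (xi x)] =
    [set xi | forall x, A x (xi x)].
  apply/seteqP; split => xi /= H x; rewrite /A; first by case: ifPn => // /H.
  by move=> xS; have := H x; rewrite /A xS.
rewrite /gaussian_field ptws_power_rect; last first.
  by move=> x; rewrite /A; case: ifP.
rewrite [RHS]big_mkcond; apply: eq_bigr => x _.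
by rewrite real_normalE /A; case: ifP => // _; rewrite probability_setT.
Qed.

Lemma gaussian_field_iid :
  iid_std_gaussian (fun x => coordinate x : {RV gaussian_field >-> R}).
Proof.
have E1 x (B : set R) : measurable B ->
    gaussian_field [set xi | B (xi x)] = normal_prob 0 1 B.
  move=> mB; have := @gaussian_field_rect [set x]%SET (fun=> B) (fun=> mB).
  rewrite big_set1 => <-; congr (gaussian_field _).
  by apply/seteqP; split => xi /= H; [move=> y /set1P ->|apply: H; exact/set1P].
split=> [x B mB|S B mB]; first exact: E1.
rewrite [LHS]gaussian_field_rect//; apply: eq_bigr => x _.
by rewrite -(E1 x _ (mB x)).
Qed.

End gaussian_field.

(** * Dominated convergence for the rescaled field *)

Section large_mass.
Variables (R : realType) (X : finType).
Local Notation RX := {ptws X -> R}.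
Variables (D : RX -> R) (beta : R).
Hypotheses (D0 : forall xi, 0 <= D xi) (mD : measurable_fun setT D).
Hypothesis DZ : forall (c : R) xi, D (fun x => c * xi x) = c ^+ 2 * D xi.
Hypothesis beta_gt0 : 0 < beta.

Local Notation gamma := (@gaussian_field R X).
Local Notation energy m xi := (D xi + m ^+ 2 / 2 * \sum_x xi x ^+ 2).

(** Up to normalisation, the density of the rescaled field with respect to the standard Gaussian
    measure. *)
Let mass_factor (m : R) (eta : RX) : R := expR (- (D eta / m ^+ 2)).

Let mass_factor_le1 m eta : 0 <= mass_factor m eta <= 1.
Proof.
by rewrite expR_ge0 -[leRHS]expR0 ler_expR oppr_le0 divr_ge0// sqr_ge0.
Qed.

Let measurable_mass_factor m : measurable_fun setT (mass_factor m).
Proof.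
apply: measurableT_comp => //; apply: measurableT_comp => //.
exact: measurable_funM.
Qed.

Let measurable_boltzmann m :
  measurable_fun setT (fun xi : RX => expR (- (beta * energy m xi))).
Proof.
apply: measurableT_comp => //; apply: measurableT_comp => //.
apply: measurable_funM => //; apply: measurable_funD => //.
by apply: measurable_funM => //; exact: measurable_sum_sqr.
Qed.

Let integrable_mass (f : RX -> R) (M m : R) :
  measurable_fun setT f -> (forall xi, 0 <= f xi <= M) ->
  gamma.-integrable setT (fun eta => (f eta * mass_factor m eta)%:E).
Proof.
move=> mf fM; apply: (@le_integrable _ _ _ gamma _ measurableT _ (EFin \o cst M)).
- by apply/measurable_EFinP; exact: measurable_funM.
- move=> eta _ /=; rewrite lee_fin.
  have /andP[f0 fm] := fM eta; have /andP[w0 w1] := mass_factor_le1 m eta.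
  rewrite !ger0_norm ?mulr_ge0//; last exact: le_trans fm.
  by rewrite -[leRHS]mulr1 ler_pM.
- by apply: finite_measure_integrable_cst.
Qed.

(* For the field, D eta = eta^T (I - P) eta / 2. *)
Definition mass_mean (f : RX -> R) (m : R) : R :=
  fine (\int[gamma]_eta (f eta * expR (- (D eta / m ^+ 2)))%:E)%E.

Let mass_meanE (f : RX -> R) (M m : R) :
  measurable_fun setT f -> (forall xi, 0 <= f xi <= M) ->
  (\int[gamma]_eta (f eta * mass_factor m eta)%:E)%E = (mass_mean f m)%:E.
Proof.
by move=> mf fM; rewrite fineK//; apply: integrable_fin_num (integrable_mass m mf fM).
Qed.

(** Under eta = sqrt(beta) m xi the mass term becomes the standard Gaussian weight, and homogeneity
    of D turns beta D(xi) into D(eta) / m^2. *)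
Let scaled_integral (f : RX -> R) (M m : R) : 0 < m ->
  measurable_fun setT f -> (forall xi, 0 <= f xi <= M) ->
  (\int[ptws_lebesgue R X]_xi (f (fun x => Num.sqrt beta * m * xi x) *
     expR (- (beta * energy m xi)))%:E)%E =
  (mass_mean f m / ((Num.sqrt beta * m / Num.sqrt (2 * pi)) ^+ #|X|))%:E.
Proof.
move=> m0 mf fM; set c := Num.sqrt beta * m.
have c0 : 0 < c by rewrite mulr_gt0// sqrtr_gt0.
set K := (c / _) ^+ _.
have K0 : 0 < K by rewrite exprn_gt0// divr_gt0// sqrtr_gt0 mulr_gt0// pi_gt0.
have := mass_meanE m mf fM.
rewrite (ge0_integral_gaussian_field c0)//; last 2 first.
- by apply/measurable_EFinP; exact: measurable_funM.
- move=> xi; rewrite lee_fin mulr_ge0//; first by case/andP: (fM xi).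
  by case/andP: (mass_factor_le1 m xi).
rewrite -/K => E.
rewrite [X in _ = X%:E]mulrC EFinM -E muleA -EFinM mulVf ?gt_eqF// mul1e.
apply: eq_integral => xi _; rewrite -EFinM; congr _%:E.
rewrite -[RHS]mulrA; congr (_ * _).
rewrite /mass_factor DZ -expRD; congr expR.
rewrite /c exprMn sqr_sqrtr ?ltW//; field.
by rewrite gt_eqF.
Qed.

(** The partition function is the case f = 1 of [scaled_integral], so the Jacobian constant [K]
    cancels in the quotient. *)
Lemma scaled_expectation m d (Om : measurableType d) (P : probability Om R)
    (g : X -> {RV P >-> R}) (f : RX -> R) (M : R) : 0 < m ->
  (forall A : set RX, measurable A -> P [set w | A (fun x => g x w)] =
    \int[ptws_lebesgue R X]_(xi in A) (expR (- (beta * energy m xi)) /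
      fine (\int[ptws_lebesgue R X]_eta (expR (- (beta * energy m eta)))%:E))%:E)%E ->
  measurable_fun setT f -> (forall xi, 0 <= f xi <= M) ->
  'E_P[fun w => f (fun x => (Num.sqrt beta * m * g x w)%R)]%E =
  (mass_mean f m / mass_mean (cst 1) m)%:E.
Proof.
move=> m0 law mf fM.
set Z := (X in fine X) in law.
set c := Num.sqrt beta * m.
set K := (c / Num.sqrt (2 * pi)) ^+ #|X|.
have c0 : 0 < c by rewrite mulr_gt0// sqrtr_gt0.
have K0 : 0 < K by rewrite exprn_gt0// divr_gt0// sqrtr_gt0 mulr_gt0// pi_gt0.
have ZE : Z = (mass_mean (cst 1) m / K)%:E.
  rewrite /K /c -(@scaled_integral (cst 1) 1 m)//; last by move=> _ /=; rewrite ler01 lexx.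
  by apply: eq_integral => xi _; rewrite mul1r.
have Z0 : 0 <= fine Z.
  by apply: fine_ge0; apply: integral_ge0 => xi _; rewrite lee_fin expR_ge0.
have mrho : measurable_fun setT (fun xi : RX => expR (- (beta * energy m xi)) / fine Z).
  by apply: measurable_funM.
have rho0 (xi : RX) : 0 <= expR (- (beta * energy m xi)) / fine Z.
  by rewrite divr_ge0// expR_ge0.
have mfc : measurable_fun setT (fun xi : RX => (f (fun x => c * xi x))%:E).
  apply/measurable_EFinP; apply: (measurableT_comp mf).
  exact: measurable_scale_ptws.
rewrite unlock (ge0_integral_law rho0 mrho law mfc); last first.
  by move=> xi; rewrite lee_fin; case/andP: (fM (fun x => c * xi x)).
under eq_integral do rewrite -EFinM mulrA mulrC EFinM.
rewrite ge0_integralZl//; last 3 first.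
- apply/measurable_EFinP; apply: measurable_funM => //.
  exact/measurable_EFinP.
- move=> xi _; rewrite lee_fin mulr_ge0 ?expR_ge0//.
  by case/andP: (fM (fun x => c * xi x)).
- by rewrite lee_fin invr_ge0.
rewrite (scaled_integral m0 mf fM) -/c -/K ZE -EFinM /= invf_div; congr _%:E.
by rewrite mulrC mulrA divfK// gt_eqF.
Qed.

(** Along any sequence of masses tending to infinity the mass factor tends to 1, and the constant M
    dominates. *)
Lemma cvg_mass_mean (f : RX -> R) (M : R) :
  measurable_fun setT f -> (forall xi, 0 <= f xi <= M) ->
  mass_mean f m @[m --> +oo] --> fine (\int[gamma]_eta (f eta)%:E)%E.
Proof.
move=> mf fM; apply/cvg_pinftyP => u uoo.
apply: fine_cvg; rewrite fineK; last first.
  apply: integrable_fin_num => //.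
  apply: (@measurable_bounded_integrable _ _ _ gamma f setT) => //.
    by rewrite -ge0_fin_numE// fin_num_measure.
  exists M; split; first exact: num_real.
  move=> B MB xi _ /=; have /andP[f0 fm] := fM xi.
  by rewrite ger0_norm// (le_trans fm)// ltW.
have [] := @dominated_convergence _ _ _ gamma _ measurableT
  (fun n eta => (f eta * mass_factor (u n) eta)%:E) (fun eta => (f eta)%:E) (cst M%:E).
- by move=> n; apply/measurable_EFinP; exact: measurable_funM.
- exact/measurable_EFinP.
- apply: aeW => eta _; apply: cvg_EFin; first exact: nearW.
  rewrite -[X in _ --> X]mulr1; apply: cvgM; first exact: cvg_cst.
  rewrite -expR0; apply: continuous_cvg; first exact: continuous_expR.
  rewrite -[X in _ --> X]oppr0; apply: cvgN.
  rewrite -[X in _ --> X](mulr0 (D eta)); apply: cvgM; first exact: cvg_cst.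
  have uV : (u n)^-1 @[n --> \oo] --> 0.
    by apply/gtr0_cvgV0 => //; move/cvgryPgt : uoo; exact.
  have -> : (fun n => (u n ^+ 2)^-1) = (fun n => (u n)^-1 * (u n)^-1).
    by apply/funext => n; rewrite expr2 invfM.
  by rewrite -[X in _ --> X](mulr0 0); exact: cvgM.
- by apply: finite_measure_integrable_cst.
- apply: aeW => eta n _; rewrite lee_fin.
  have /andP[f0 fm] := fM eta; have /andP[w0 w1] := mass_factor_le1 (u n) eta.
  by rewrite ger0_norm ?mulr_ge0// -[leRHS]mulr1 ler_pM.
by move=> _ _.
Qed.

Lemma cvg_weakly_large_mass (d0 : R -> measure_display)
    (Om : forall m, measurableType (d0 m)) (P : forall m, probability (Om m) R)
    (g : forall m, X -> {RV (P m) >-> R}) :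
  (forall m : R, (0 < m)%R -> forall A : set RX, measurable A ->
    P m [set w | A (fun x => g m x w)] =
    \int[ptws_lebesgue R X]_(xi in A) (expR (- (beta * energy m xi)) /
      fine (\int[ptws_lebesgue R X]_eta (expR (- (beta * energy m eta)))%:E))%:E)%E ->
  cvg_weakly (pinfty_nbhs R) P
    (fun m x w => Num.sqrt beta * m * g m x w) gamma (@coordinate R X).
Proof.
move=> law f cf [M fM].
have mf := measurable_continuous_ptws cf.
(* Adding the bound M makes f nonnegative, as the nonnegative integral formulas require; M is
   subtracted again at the end. *)
have shift d (Om' : measurableType d) (Q : probability Om' R) (Y : X -> Om' -> R) :
    (forall x, measurable_fun setT (Y x)) ->
    'E_Q[fun w => f (fun x => Y x w)]%E =
    ('E_Q[fun w => (f (fun x => Y x w) + M)%R] - M%:E)%E.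
  move=> mY; pose G w : RX := fun x => Y x w.
  have mfG : measurable_fun setT (f \o G).
    by apply: measurableT_comp => //; exact: measurable_ptws.
  have ifG : Q.-integrable setT (EFin \o (f \o G)).
    apply: measurable_bounded_integrable => //.
      by rewrite -ge0_fin_numE// fin_num_measure.
    exists M; split; first exact: num_real.
    by move=> B MB w _ /=; rewrite (le_trans (fM _))// ltW.
  rewrite unlock; under [in RHS]eq_integral do rewrite EFinD.
  rewrite integralD//; last exact: finite_measure_integrable_cst.
  rewrite integral_cst// [X in (_ + _ * X - _)%E](@probability_setT _ _ _ Q).
  by rewrite mule1 addeK.
pose F xi := f xi + M.
have mF : measurable_fun setT F by exact: measurable_funD.
have FM xi : 0 <= F xi <= M + M.
  by rewrite /F; have := fM xi; rewrite ler_norml; lra.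
have one_le (xi : RX) : 0 <= (cst 1 : RX -> R) xi <= 1 by rewrite ler01 lexx.
have l1 := cvg_mass_mean mF FM.
have := @cvg_mass_mean (cst 1) 1 (measurable_cst _) one_le.
have -> : (\int[gamma]_eta ((cst 1 : RX -> R) eta)%:E = 1)%E.
  rewrite (eq_integral (fun=> 1%:E))// integral_cst//.
  by rewrite [X in (_ * X)%E](@probability_setT _ _ _ gamma) mule1.
move=> /= l2.
have l : (mass_mean F m / mass_mean (cst 1) m - M)%:E @[m --> +oo] -->
    (fine (\int[gamma]_eta (F eta)%:E) - M)%:E.
  apply: cvg_EFin; first exact: nearW.
  apply: cvgB; last exact: cvg_cst.
  rewrite -[X in _ --> X]divr1; apply: cvgM => //.
  by apply: cvgV => //; rewrite oner_eq0.
rewrite (shift _ _ _ (@coordinate R X)); last exact: measurable_coordinate.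
have -> : ('E_gamma[fun w => (f (fun x => coordinate x w) + M)%R] - M%:E)%E =
    (fine (\int[gamma]_eta (F eta)%:E) - M)%:E.
  rewrite EFinB fineK ?unlock//; apply: integrable_fin_num => //.
  apply: measurable_bounded_integrable => //.
    by rewrite -ge0_fin_numE// fin_num_measure.
  exists (M + M); split; first exact: num_real.
  move=> B MB xi _ /=; have /andP[F0 FMM] := FM xi.
  by rewrite ger0_norm// (le_trans FMM)// ltW.
apply: cvg_trans l; apply: near_eq_cvg; near=> m.
have m0 : 0 < m by near: m; exact: nbhs_pinfty_gt.
rewrite shift; last by move=> x; exact: measurable_funM.
by rewrite (scaled_expectation m0 (law m m0) mF FM).
Unshelve. all: by end_near. Qed.

End large_mass.

(** * The Gaussian free field *)

Section hamming_field.
Variables (R : realType) (d n' : nat) (J : nat -> R).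
Local Notation n := n'.+1.
Hypothesis n'_gt0 : (0 < n')%N.
Hypothesis J_ge0 : forall i, (1 <= i <= d)%N -> 0 <= J i.

Lemma measurable_dirichlet :
  measurable_fun setT (fun xi : {ptws vertex d n -> R} => dirichlet J xi).
Proof.
apply: measurable_sum => x; apply: measurable_sum => y.
apply: measurable_funM => //; apply: measurable_funX.
by apply: measurable_funB; exact: measurable_ptws_eval.
Qed.

Lemma dirichletZ (c : R) (xi : vertex d n -> R) :
  dirichlet J (fun x => c * xi x) = c ^+ 2 * dirichlet J xi.
Proof.
rewrite /dirichlet mulr_sumr; apply: eq_bigr => x _.
by rewrite mulr_sumr; apply: eq_bigr => y _; ring.
Qed.

Lemma gff_cvg_weakly (beta : R) (d0 : R -> measure_display)
    (Om : forall m, measurableType (d0 m)) (P : forall m, probability (Om m) R)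
    (g : forall m, vertex d n -> {RV (P m) >-> R}) : 0 < beta ->
  (forall m : R, 0 < m -> is_gff J beta m (g m)) ->
  cvg_weakly (pinfty_nbhs R) P
    (fun (m : R) x w => Num.sqrt beta * m * g m x w)
    (@gaussian_field R (vertex d n)) (@coordinate R (vertex d n)).
Proof.
move=> beta0 gff.
pose D (xi : {ptws vertex d n -> R}) := 4^-1 * dirichlet J xi.
have D0 xi : 0 <= D xi by rewrite mulr_ge0 ?dirichlet_ge0.
have mD : measurable_fun setT D.
  by apply: measurable_funM => //; exact: measurable_dirichlet.
have DZ (c : R) xi : D (fun x => c * xi x) = c ^+ 2 * D xi.
  by rewrite /D dirichletZ mulrCA.
apply (cvg_weakly_large_mass D0 mD DZ beta0).
move=> m m0 A mA.
have E : hamiltonian J m = (fun xi : {ptws vertex d n -> R} =>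
    D xi + m ^+ 2 / 2 * \sum_x xi x ^+ 2).
  by apply/funext => xi; rewrite hamiltonian_dirichlet.
by have := gff m m0 A mA; rewrite /partition_function E.
Qed.

(** The index 0 has lambda_0 = 1 and multiplicity 1, so it contributes the lone factor m2, the
    source of the divergence of the partition function as m tends to 0. *)
Lemma det_massive (beta m2 : R) :
  \det (radial_mx d n' (fun j => beta * massive_kernel d n' J m2 j)) =
  beta ^+ (n ^ d) *
  (m2 * \prod_(1 <= i < d.+1) (1 + m2 - eigenval d n J i) ^+ kappa d n i).
Proof.
have -> : radial_mx d n' (fun j => beta * massive_kernel d n' J m2 j) =
    beta *: radial_mx d n' (massive_kernel d n' J m2).
  by apply/matrixP => a b; rewrite !mxE.
rewrite detZ det_radial_mx card_ffun !card_ord; congr (_ * _).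
have k0 : kappa d n 0 = 1%N by rewrite /kappa bin0 expn0.
rewrite big_ltn// radial_eigenval_massive// eigenval0// k0 expr1.
rewrite [_ + _ - 1]addrAC subrr add0r; congr (_ * _).
apply: eq_big_nat => i /andP[_]; rewrite ltnS => id.
by rewrite radial_eigenval_massive.
Qed.

Lemma partition_functionE (beta m : R) : 0 < beta -> 0 < m ->
  partition_function d n J beta m =
  (Num.sqrt ((2 * pi / beta) ^+ (n ^ d) / (m ^+ 2 *
    \prod_(1 <= i < d.+1) (1 + m ^+ 2 - eigenval d n J i) ^+ kappa d n i)))%:E.
Proof.
move=> b0 m0; rewrite /partition_function.
have mH : measurable_fun setT (fun xi : {ptws vertex d n -> R} =>
    (expR (- (beta * hamiltonian J m xi)))%:E).
  apply/measurable_EFinP; apply: measurableT_comp => //.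
  apply: measurableT_comp => //; apply: measurable_funM => //.
  rewrite (_ : hamiltonian J m = fun xi : {ptws vertex d n -> R} =>
      4^-1 * dirichlet J xi + m ^+ 2 / 2 * \sum_x xi x ^+ 2); last first.
    by apply/funext => xi; rewrite hamiltonian_dirichlet.
  apply: measurable_funD; apply: measurable_funM => //.
    exact: measurable_dirichlet.
  exact: measurable_sum_sqr.
rewrite [LHS](ge0_integral_ptws_power _ mH); last by move=> xi; rewrite lee_fin expR_ge0.
pose A := radial_mx d n' (fun j => beta * massive_kernel d n' J (m ^+ 2) j).
have AT : A^T = A by exact: radial_mx_sym.
have [_ gA] := gaussian_integral AT (massive_pos_def J_ge0 b0 m0).
transitivity (\int[tuple_power (real_lebesgue R) #|vertex d n|]_t
    (expR (- (2^-1 * quad_form A (tnth t))))%:E)%E.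
  apply: eq_integral => t _; congr (expR (- _))%:E.
  have -> : tnth t = (fun i => ptws_of_tuple t (enum_val i)).
    by apply/funext => i; rewrite /ptws_of_tuple enum_valK.
  rewrite quad_form_radial_mx hamiltonianE mulrCA; congr (_ * _).
  rewrite mulr_sumr; apply: eq_bigr => x _; rewrite mulrCA; congr (_ * _).
  by rewrite mulr_sumr; apply: eq_bigr => y _; rewrite mulrA.
rewrite gA det_massive card_ffun !card_ord; congr (Num.sqrt _)%:E.
by rewrite invfM mulrA -exprVn -exprMn.
Qed.

Lemma sqrt_prod (I : Type) (r : seq I) (F : I -> R) :
  (forall i, 0 <= F i) ->
  Num.sqrt (\prod_(i <- r) F i) = \prod_(i <- r) Num.sqrt (F i).
Proof.
move=> F0; elim: r => [|i r IH]; first by rewrite !big_nil sqrtr1.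
by rewrite !big_cons sqrtrM// IH.
Qed.

Lemma sqrt_exp_powR (a : R) k : 0 <= a -> Num.sqrt (a ^+ k) = a `^ (k%:R / 2).
Proof. by move=> a0; rewrite powRrM powR_mulrn// powR12_sqrt ?exprn_ge0. Qed.

Lemma mass_partition_function_cvg (beta : R) : 0 < beta ->
  irreducible_mx (transition d n J) ->
  (m%:E * partition_function d n J beta m)%E @[m --> 0^'+] -->
    ((2 * pi / beta) `^ ((n ^ d)%:R / 2) *
     \prod_(1 <= i < d.+1)
       (1 - eigenval d n J i) `^ (- ((kappa d n i)%:R / 2)))%:E.
Proof.
move=> b0 irr.
(* Written as a polynomial in m, the product over i >= 1 is continuous at 0; its value there is
   positive by [eigenval_lt1]. *)
pose q : {poly R} := \prod_(1 <= i < d.+1)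
  ((1 - eigenval d n J i)%:P + 'X ^+ 2) ^+ kappa d n i.
have qE m : q.[m] = \prod_(1 <= i < d.+1)
    (1 + m ^+ 2 - eigenval d n J i) ^+ kappa d n i.
  rewrite horner_prod; apply: eq_bigr => i _.
  by rewrite horner_exp !hornerE addrAC.
have lt1 i : (1 <= i < d.+1)%N -> 0 < 1 - eigenval d n J i.
  by rewrite ltnS => id; rewrite subr_gt0 eigenval_lt1.
have q0 : 0 < q.[0].
  rewrite qE big_nat_cond; apply: prodr_gt0 => i /andP[id _].
  by rewrite expr0n addr0 exprn_gt0// lt1.
pose C := (2 * pi / beta) ^+ (n ^ d).
have C0 : 0 < 2 * pi / beta by rewrite divr_gt0// mulr_gt0// pi_gt0.
have -> : (2 * pi / beta) `^ ((n ^ d)%:R / 2) *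
    \prod_(1 <= i < d.+1) (1 - eigenval d n J i) `^ (- ((kappa d n i)%:R / 2)) =
    Num.sqrt (C / q.[0]).
  (* The absolute values make every factor nonnegative, also outside the summation range, as
     [sqrt_prod] demands. *)
  have -> : q.[0] = \prod_(1 <= i < d.+1) `|1 - eigenval d n J i| ^+ kappa d n i.
    rewrite qE; apply: eq_big_nat => i /lt1 i0.
    by rewrite expr0n addr0 gtr0_norm.
  rewrite sqrtrM ?exprn_ge0 ?ltW// -sqrt_exp_powR ?ltW//; congr (_ * _).
  rewrite sqrtrV; last by apply: prodr_ge0 => i _; exact: exprn_ge0.
  rewrite sqrt_prod => [|i]; last exact: exprn_ge0.
  rewrite -prodfV; apply: eq_big_nat => i /lt1 i0.
  by rewrite sqrt_exp_powR// gtr0_norm// powRN.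
have lim : (Num.sqrt (C / q.[m]))%:E @[m --> 0^'+] --> (Num.sqrt (C / q.[0]))%:E.
  apply: cvg_EFin; first exact: nearW.
  apply: cvg_at_right_filter; apply: continuous_cvg; first exact: sqrt_continuous.
  apply: cvgM; first exact: cvg_cst.
  by apply: cvgV; [rewrite gt_eqF|exact: continuous_horner].
apply: cvg_trans lim; apply: near_eq_cvg; near=> m.
have m0 : 0 < m by near: m; exact: nbhs_right_gt.
(* For m > 0 the factor m^2 leaves the square root as 1 / m and cancels the prefactor exactly. *)
rewrite partition_functionE// -qE -EFinM; congr _%:E.
rewrite invfM mulrCA [in RHS]sqrtrM ?invr_ge0 ?sqr_ge0//.
by rewrite sqrtrV ?sqr_ge0// sqrtr_sqr gtr0_norm// mulVKf// gt_eqF.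
Unshelve. all: by end_near. Qed.

End hamming_field.

Theorem corollary3p4 (R : realType) (d n : nat) (beta : R) (J : nat -> R)
    (hd : (2 <= d)%N) (hn : (2 <= n)%N) (hbeta : 0 < beta)
    (hJ : forall i, (1 <= i <= d)%N -> 0 <= J i)
    (hJsum : \sum_(1 <= i < d.+1) (kappa d n i)%:R * J i <= 1) :
  (forall (d0 : R -> measure_display) (Om : forall m, measurableType (d0 m))
      (P : forall m, probability (Om m) R)
      (g : forall m, vertex d n -> {RV (P m) >-> R}),
    (forall m : R, 0 < m -> is_gff J beta m (g m)) ->
    exists (d1 : measure_display) (Om1 : measurableType d1)
        (P1 : probability Om1 R) (N : vertex d n -> {RV P1 >-> R}),
      iid_std_gaussian N /\
      cvg_weakly (pinfty_nbhs R) P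
        (fun (m : R) x w => Num.sqrt beta * m * g m x w) P1 N) /\
  (irreducible_mx (transition d n J) ->
    (m%:E * partition_function d n J beta m)%E @[m --> 0^'+] -->
    ((2 * pi / beta) `^ ((n ^ d)%:R / 2) *
     \prod_(1 <= i < d.+1)
       (1 - eigenval d n J i) `^ (- ((kappa d n i)%:R / 2)))%:E).
Proof.
(* Writing n as [n'.+1] supplies the letter 0; the bound n >= 2 then reads 0 < n'. *)
case: n hn hJsum => [//|n'] n1 _; split => [d0 Om P g gff|irr].
  exists _, {ptws vertex d n'.+1 -> R}, (@gaussian_field R (vertex d n'.+1)).
  exists (fun x => @coordinate R (vertex d n'.+1) x); split.
    exact: gaussian_field_iid.
  by have := gff_cvg_weakly hJ hbeta gff; exact id.
exact (mass_partition_function_cvg n1 hJ hbeta irr).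
Qed.
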